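(* Let $\lambda_-$ and $\lambda_+$ be real exponents with $\mathfrak q/q \le \lambda_- < 1 < \lambda_+ \le \mathfrak p/p$ such that $\mathfrak R$ is both of weak $\lambda_-$-type and of weak $\lambda_+$-type. Then for every $\tau \in (\lambda_-, \lambda_+)$ the operator $\mathfrak R$ is of strong $\tau$-type; that is, there is a constant $C$ (independent of $\mathfrak f$) such that $$\int_{\mathbb X} [\mathfrak R \mathfrak f]^\tau\, dx \le C \int_{\mathbb X} [\mathfrak f]^\tau\, dx \quad \text{for all } \mathfrak f \in \mathscr L^\ast(\mathbb X) \times \mathscr L^\ast(\mathbb X).$$
   Context: $(\mathbb X,dx)$ is a $\sigma$-finite measure space, $\mathbb V$ a finite dimensional inner product space with inner product $\langle\cdot|\cdot\rangle$ and norm $|\cdot|$, and $\mathscr L^s(\mathbb X)=\mathscr L^s(\mathbb X,\mathbb V)$. $\mathscr L^2_+(\mathbb X)$ is a fixed closed subspace of $\mathscr L^2(\mathbb X)$, $\mathscr L^2_-(\mathbb X)$ its orthogonal complement, and $\Pi_\pm$ the orthogonal projections onto $\mathscr L^2_\pm(\mathbb X)$. Standing assumption: for some $1\le \mathfrak q<2$ there is a constant $K$ with $\operatorname{meas}\{x : |\Pi_+\omega(x)|>t\} \le K t^{-\mathfrak q}\int_{\mathbb X}|\omega|^{\mathfrak q}$ for all $t>0$ and $\omega \in \mathscr L^2(\mathbb X)\cap\mathscr L^{\mathfrak q}(\mathbb X)$. Let $\mathfrak p\in(2,\infty]$ be the Hölder conjugate of $\mathfrak q$. Then $\Pi_\pm$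 extend to bounded operators on $\mathscr L^s(\mathbb X)$ for $\mathfrak q<s<\mathfrak p$; for such $s$, $\mathscr L^s_\pm(\mathbb X)$ denotes the closure of $\mathscr L^2_\pm(\mathbb X)\cap\mathscr L^s(\mathbb X)$ in $\mathscr L^s(\mathbb X)$. Fix Hölder conjugate exponents $p,q$ ($1/p+1/q=1$) with $\mathfrak q<q\le p<\mathfrak p$. $\mathfrak A:\mathbb X\times\mathbb V\to\mathbb V$ is a given function such that: $x\mapsto\mathfrak A(x,v)$ is measurable for every $v\in\mathbb V$ and $v\mapsto\mathfrak A(x,v)$ is continuous for almost every $x$; $\mathfrak A(x,\lambda v)=\lambda^{p-1}\mathfrak A(x,v)$ for $\lambda\ge0$; and there are constants $L,m>0$ independent of $x,v_1,v_2$ such that $|\mathfrak A(x,v_1)-\mathfrak A(x,v_2)|\le L(|v_1|+|v_2|)^{p-2}|v_1-v_2|$ and $\langle\mathfrak A(x,v_1)-\mathfrak A(x,v_2)\,|\,v_1-v_2\rangle\ge m(|v_1|+|v_2|)^{p-2}|v_1-v_2|^2$. For every $\mathfrak f=(\mathfrak a,\mathfrak b)\in\mathscr L^p(\mathbb X)\times\mathscr L^q(\mathbb X)$ there is a unique $\phi=(\alpha,\beta)\in\mathscr L^p_+(\mathbb X)\times\mathscr L^q_-(\mathbb X)$ with $\mathfrak A(x,\mathfrak a+\alpha)=\mathfrak b+\beta$ almost everywhere; this defines the nonlinear operator $\mathfrak R\mathfrak f=\phi$ on $\mathscr L^p(\mathbb X)\times\mathscr L^q(\mathbb X)$. For a pair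 $(u,v)$ of $\mathbb V$-valued functions put $[(u,v)]=|u|^p+|v|^q$; in particular $[\mathfrak f]=|\mathfrak a|^p+|\mathfrak b|^q$ and $[\mathfrak R\mathfrak f]=|\alpha|^p+|\beta|^q$. Put $\mathscr L^\ast(\mathbb X)=\bigcap_{1\le s\le\infty}\mathscr L^s(\mathbb X,\mathbb V)$. For $\mathfrak q/q\le\lambda\le\mathfrak p/p$, $\mathfrak R$ is said to be of weak $\lambda$-type if for every $\mathfrak f\in\mathscr L^\ast(\mathbb X)\times\mathscr L^\ast(\mathbb X)$ the solution $\mathfrak R\mathfrak f$ also belongs to $\mathscr L^{\lambda p}(\mathbb X)\times\mathscr L^{\lambda q}(\mathbb X)$, and there is a constant $C$ independent of $\mathfrak f$ and $t$ such that $\operatorname{meas}\{x:[\mathfrak R\mathfrak f(x)]>t\}\le C\,t^{-\lambda}\int_{\mathbb X}[\mathfrak f]^\lambda$ for every $t>0$. *)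

(* Defs.v *)
From HB Require Import structures.
From mathcomp Require Import all_boot all_order all_algebra.
From mathcomp Require Import all_classical all_reals all_analysis.
Import numFieldNormedType.Exports.
Import Order.TTheory GRing.Theory Num.Theory.

Set Implicit Arguments.
Unset Strict Implicit.
Unset Printing Implicit Defensive.

Local Open Scope classical_set_scope.
Local Open Scope ring_scope.

(* Finite dimensional normed spaces.  An inner product space is such a space V
   together with a form [ip : {dot V for idfun}] (bilinear, symmetric and
   positive definite) that induces its norm. *)
#[short(type="normedVectType")]
HB.structure Definition NormedVector (K : numFieldType) :=
  {V of NormedModule K V & Vector K V}.

Definition induces_norm (R : realType) (V : normedVectType R)
    (ip : V -> V -> R) : Prop :=
  forall v : V, `|v| ^+ 2 = ip v v.

Section LebesgueSpaces.
Context (R : realType) (d : measure_display) (T : measurableType d)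
  (mu : {measure set T -> \bar R}) (V : normedVectType R).
Implicit Types (f g w : T -> V) (H : set (T -> V)).

(* Borel measurability *)
Definition vmeasurable f : Prop :=
  forall U : set V, open U -> measurable (f @^-1` U).

(* Elements of L^s are represented by genuine functions T -> V; functions that
   agree almost everywhere are at L^s-distance 0 and are not identified. *)
Definition Lsp (s : \bar R) : set (T -> V) :=
  [set f | vmeasurable f /\ finite_norm mu s (fun x => `|f x|)].

Definition Ldist (s : \bar R) f g : \bar R :=
  Lnorm mu s (fun x => `|f x - g x|%:E).

(* the closure in L^s of H `&` L^s *)
Definition Lclosure (s : \bar R) H : set (T -> V) :=
  [set f | Lsp s f /\ forall e : R, 0 < e ->
    exists2 g, H g /\ Lsp s g & (Ldist s f g < e%:E)%E].

(* Closedness makes H saturated for equality almost everywhere. *)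
Definition closed_subspaceL2 H : Prop :=
  [/\ H `<=` Lsp 2%:E,
      H (fun=> 0),
      forall (a : R) f g, H f -> H g -> H (fun x => a *: f x + g x)
    & Lclosure 2%:E H `<=` H].

Definition orthoL2 (ip : V -> V -> R) H : set (T -> V) :=
  [set f | Lsp 2%:E f /\
    forall g, H g -> (\int[mu]_x (ip (f x) (g x))%:E = 0)%E].

(* [orthprojL2 ip H w g]: g represents the orthogonal projection of w on H *)
Definition orthprojL2 (ip : V -> V -> R) H w g : Prop :=
  H g /\ orthoL2 ip H (fun x => w x - g x).

Definition weak_type_projection (ip : V -> V -> R) H (s : R) : Prop :=
  exists K : R, forall w g, Lsp 2%:E w -> Lsp s%:E w -> orthprojL2 ip H w g ->
    forall t : R, 0 < t ->
      (mu [set x | (t < `|g x|)%R] <=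
         K%:E * (t `^ (- s))%:E * \int[mu]_x (`|w x| `^ s)%:E)%E.

Definition Lstar : set (T -> V) :=
  [set f | forall s : \bar R, (1 <= s)%E -> Lsp s f].

Definition structure_conditions (ip : V -> V -> R) (p L m : R)
    (A : T -> V -> V) : Prop :=
  [/\ forall v, vmeasurable (A ^~ v),
      {ae mu, forall x, continuous (A x)},
      forall x (l : R) v, 0 <= l -> A x (l *: v) = l `^ (p - 1) *: A x v,
      forall x v1 v2,
        `|A x v1 - A x v2| <= L * (`|v1| + `|v2|) `^ (p - 2) * `|v1 - v2|
    & forall x v1 v2,
        m * (`|v1| + `|v2|) `^ (p - 2) * `|v1 - v2| ^+ 2 <=
        ip (A x v1 - A x v2) (v1 - v2)].

Local Notation pairs := ((T -> V) * (T -> V))%type.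
Implicit Types (F phi : pairs) (Rop : pairs -> pairs).

Definition solves (ip : V -> V -> R) (p q : R) (A : T -> V -> V) H
    F phi : Prop :=
  [/\ Lclosure p%:E H phi.1,
      Lclosure q%:E (orthoL2 ip H) phi.2
    & {ae mu, forall x, A x (F.1 x + phi.1 x) = F.2 x + phi.2 x}].

(* Solutions are unique up to equality almost everywhere, so this determines
   Rop on L^p x L^q up to the choice of representatives. *)
Definition solution_operator (ip : V -> V -> R) (p q : R) (A : T -> V -> V) H
    Rop : Prop :=
  forall F, Lsp p%:E F.1 -> Lsp q%:E F.2 -> solves ip p q A H F (Rop F).

Definition bracket (p q : R) F (x : T) : R :=
  `|F.1 x| `^ p + `|F.2 x| `^ q.

Definition weak_type (p q : R) Rop (l : R) : Prop :=
  (forall F, Lstar F.1 -> Lstar F.2 ->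
     Lsp (l * p)%:E (Rop F).1 /\ Lsp (l * q)%:E (Rop F).2) /\
  exists C : R, forall F, Lstar F.1 -> Lstar F.2 ->
    forall t : R, 0 < t ->
      (mu [set x | (t < bracket p q (Rop F) x)%R] <=
         C%:E * (t `^ (- l))%:E * \int[mu]_x (bracket p q F x `^ l)%:E)%E.

Definition strong_type (p q : R) Rop (tau : R) : Prop :=
  exists C : R, forall F, Lstar F.1 -> Lstar F.2 ->
    (\int[mu]_x (bracket p q (Rop F) x `^ tau)%:E <=
       C%:E * \int[mu]_x (bracket p q F x `^ tau)%:E)%E.

End LebesgueSpaces.

(* Main.v *)
Require Import Defs.
From HB Require Import structures.
From mathcomp Require Import all_boot all_order all_algebra.
From mathcomp Require Import all_classical all_reals all_analysis.
From mathcomp Require Import measurable_realfun ess_sup_inf ring lra.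
Import numFieldNormedType.Exports.
Import Order.TTheory GRing.Theory Num.Theory.
Local Open Scope classical_set_scope.
Local Open Scope ring_scope.

Set Implicit Arguments.
Unset Strict Implicit.
Unset Printing Implicit Defensive.

(** The operator is nonlinear, so the images of the two pieces of a truncated
    datum cannot be added up as in the Marcinkiewicz theorem.  What replaces
    subadditivity is an energy estimate for the difference of two solutions.
    Below, B stands for the bracket of a pair.

    Let [G] arise from [F = (a, b)] by setting the data to 0 on a set [P], let
    [phi], [psi] be the solutions for [F], [G], and let [xi = a + phi.1] and
    [eta = G.1 + psi.1].  The differences of the two components of [phi] and
    [psi] lie in the orthogonal spaces L^p_+ and L^q_-, so their inner product
    has integral 0 ([orthogonal_closures]).  Together with the monotonicity of
    the field this gives ([energy_estimate])

      int |xi - eta|^p <= C int_P (B(F) + |a|^2 |psi.1|^(p - 2)).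

    Only data on [P] appear on the right.  Since B(phi) is at most a constant
    times B(F) + B(G) + B(psi) + |xi - eta|^p ([solution_bracket_le]), the set
    where B(phi) exceeds a multiple of t is covered by three sets: where
    B(F) > t, where B(psi) > t, which the weak-type hypothesis controls, and
    where |xi - eta|^p > t, which the energy controls by Chebyshev's inequality.

    For tau > 1 one removes the data where B(F) > t and uses the weak type
    [lplus]; for tau < 1 one removes the data where B(F) <= t and uses the weak
    type [lminus].  In both cases the term |a|^2 |psi.1|^(p - 2) is bounded by
    B(F) plus a function of B(psi) whose integral Kolmogorov's inequality
    ([weak_type_integral_min]) deduces from the weak-type bound.  For tau < 1
    this function grows like the power (p - 2) / p of B(psi), and
    (p - 2) / p < 1 / q <= [lminus].  Here it matters that the error in the
    energy estimate has the exponent p - 2 and not p - 1: the latter would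
    produce the power 1 / q, which may be equal to [lminus].

    Either way the distribution function of the solution is bounded at each
    level by two truncated integrals of the data, with the exponents 1 and
    [lplus], or [lminus] and 1 ([distribution_estimate]), and summing over dyadic
    levels ([interpolation]) gives the strong type strictly between them.  The
    remaining case tau = 1 is the energy estimate against the zero solution. *)

(** * Power inequalities *)

Lemma powR_mono (R : realType) (r x y : R) :
  0 <= r -> 0 <= x -> x <= y -> x `^ r <= y `^ r.
Proof.
move=> r0 x0 xy; apply: ge0_ler_powR => //; rewrite nnegrE //.
exact: le_trans xy.
Qed.

(** The sum is at most twice the larger term, which costs only [2 `^ r] and
    avoids convexity, so that exponents below 1 are covered as well. *)
Lemma powRD_le (R : realType) (r x y : R) :
  0 <= r -> 0 <= x -> 0 <= y ->
  (x + y) `^ r <= 2 `^ r * (x `^ r + y `^ r).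
Proof.
move=> r0; wlog xy : x y / x <= y => [hw x0 y0|x0 y0].
  case: (leP x y) => xy; first exact: hw.
  by rewrite addrC [X in _ * X]addrC hw // ltW.
apply: (@le_trans _ _ ((2 * y) `^ r)).
  by apply: powR_mono => //; [exact: addr_ge0 | lra].
by rewrite powRM // ler_wpM2l ?powR_ge0 // lerDr powR_ge0.
Qed.

Lemma sqr_mul_powR (R : realType) (p x : R) :
  2 <= p -> 0 <= x -> x ^+ 2 * x `^ (p - 2) = x `^ p.
Proof.
move=> p2 x0; rewrite -powR_mulrn // -powRD; first by congr powR; lra.
by apply/implyP => /eqP; lra.
Qed.

Lemma young_eps (R : realType) (p q e : R) : 0 < p -> 0 < q ->
  p^-1 + q^-1 = 1 -> 0 < e ->
  exists2 C : R, 0 <= C &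
    forall x y, 0 <= x -> 0 <= y -> x * y <= e * x `^ p + C * y `^ q.
Proof.
move=> p0 q0 pq e0; pose k := (e * p) `^ p^-1.
have ep0 : 0 < e * p by rewrite mulr_gt0.
have k0 : 0 < k by rewrite powR_gt0.
exists (k^-1 `^ q / q); first by rewrite divr_ge0 ?powR_ge0 ?ltW.
move=> x y x0 y0.
have -> : x * y = (k * x) * (k^-1 * y) by rewrite mulrACA mulfV ?gt_eqF ?mul1r.
have kx : 0 <= k * x by rewrite mulr_ge0 // ltW.
have ky : 0 <= k^-1 * y by rewrite mulr_ge0 ?invr_ge0 // ltW.
have h := conjugate_powR kx ky p0 q0 pq.
apply: (le_trans h) => {h}.
have k0' := ltW k0.
rewrite powRM // powRM ?invr_ge0 // -powRrM mulVf ?gt_eqF //.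
rewrite powRr1 ?(ltW ep0) // [X in _ + X]mulrAC lerD2r.
by rewrite mulrAC mulfK ?gt_eqF.
Qed.

(** Comparing [x] with [Num.sqrt e * y] covers [p = 2], where the power
    [p - 2] degenerates to 1 and Young's inequality has no conjugate
    exponent. *)
Lemma young_sqr_eps (R : realType) (p e : R) : 2 <= p -> 0 < e ->
  exists2 C : R, 0 <= C & forall x y, 0 <= x -> 0 <= y ->
    x ^+ 2 * y `^ (p - 2) <= e * y `^ p + C * x `^ p.
Proof.
move=> p2 e0; pose k := Num.sqrt e.
have k0 : 0 < k by rewrite sqrtr_gt0.
exists (k^-1 `^ (p - 2)); first by rewrite powR_ge0.
move=> x y x0 y0; case: (leP x (k * y)) => xy.
  apply: (@le_trans _ _ ((k * y) ^+ 2 * y `^ (p - 2))).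
    rewrite ler_wpM2r ?powR_ge0 // !expr2 ler_pM //.
  rewrite exprMn sqr_sqrtr ?(ltW e0) // -mulrA sqr_mul_powR // lerDl.
  by rewrite mulr_ge0 ?powR_ge0.
apply: (@le_trans _ _ (x ^+ 2 * (k^-1 * x) `^ (p - 2))).
  rewrite ler_wpM2l ?sqr_ge0 // powR_mono //; first by lra.
  by rewrite ler_pdivlMl ?ltW.
rewrite powRM ?invr_ge0 ?(ltW k0) // mulrCA sqr_mul_powR // lerDr.
by rewrite mulr_ge0 ?powR_ge0 // ltW.
Qed.

(** The absorption argument.  Here [u] stands for the distance of two points
    of the graph of a monotone field, [e] for the length of the second one and
    [S] for the weight in the structure conditions; the terms with a
    minus sign are the errors caused by perturbing the data by [(a, b)].
    Splitting [S u a] between [S u^2] and [S a^2] before estimating [S] is what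
    leaves the exponent [p - 2] on [e], where Young's inequality alone would
    give [p - 1]. *)
Lemma absorption (R : realType) (p q m L : R) : 2 <= p -> 0 < q ->
  p^-1 + q^-1 = 1 -> 0 < m -> 0 < L ->
  exists2 C : R, 0 <= C & forall u S a b e,
    0 <= u -> 0 <= a -> 0 <= b -> 0 <= e ->
    u `^ (p - 2) <= S -> S <= (2 * e + u) `^ (p - 2) ->
    m / 4 * u `^ p <= m * S * u ^+ 2 - b * u - L * S * u * a - a * b
      + C * (a `^ p + b `^ q + a ^+ 2 * e `^ (p - 2)).
Proof.
move=> p2 q0 pq m0 L0.
have p0 : 0 < p by lra.
have m40 : 0 < m / 4 by lra.
have [C1 C10 H1] := young_eps p0 q0 pq m40.
have [C2 C20 H2] := young_eps p0 q0 pq ltr01.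
pose K := 3 `^ (p - 2).
have K0 : 0 < K by rewrite powR_gt0.
pose N := L ^+ 2 / m.
have N0 : 0 < N by rewrite divr_gt0 // exprn_gt0.
have NK0 : 0 < N * K by rewrite mulr_gt0.
have e30 : 0 < m / 4 / (N * K) by rewrite divr_gt0.
have [C3 C30 H3] := young_sqr_eps p2 e30.
have NKC : 0 <= N * K * C3 by rewrite mulr_ge0 // ltW.
exists (C1 + C2 + 1 + N * K * C3 + N * K); first by lra.
move=> u S a b e u0 a0 b0 e0 uS Se.
have S0 : 0 <= S by apply: le_trans uS; rewrite powR_ge0.
have hSK : S <= K * (e `^ (p - 2) + u `^ (p - 2)).
  apply: le_trans Se _.
  have r0 : 0 <= p - 2 by lra.
  case: (leP e u) => eu.
    apply: (@le_trans _ _ ((3 * u) `^ (p - 2))); first by apply: powR_mono => //; lra.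
    by rewrite powRM // ler_wpM2l ?powR_ge0 // lerDr powR_ge0.
  apply: (@le_trans _ _ ((3 * e) `^ (p - 2))); first by apply: powR_mono => //; lra.
  by rewrite powRM // ler_wpM2l ?powR_ge0 // lerDl powR_ge0.
have hSu : u `^ p <= S * u ^+ 2.
  by rewrite -(sqr_mul_powR p2 u0) mulrC ler_wpM2r ?sqr_ge0.
have hcross : L * S * u * a <= m / 4 * (S * u ^+ 2) + N * (S * a ^+ 2).
  have sq : L * u * a <= m / 4 * u ^+ 2 + N * a ^+ 2.
    rewrite -(ler_pM2l m0) -subr_ge0.
    have -> : m * (m / 4 * u ^+ 2 + N * a ^+ 2) - m * (L * u * a) =
              (m / 2 * u - L * a) ^+ 2.
      by rewrite /N; field; lra.
    exact: sqr_ge0.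
  have := ler_wpM2l S0 sq.
  have -> : S * (L * u * a) = L * S * u * a by ring.
  have -> // : S * (m / 4 * u ^+ 2 + N * a ^+ 2) =
    m / 4 * (S * u ^+ 2) + N * (S * a ^+ 2) by ring.
have hSa : N * (S * a ^+ 2) <=
    N * K * (a ^+ 2 * e `^ (p - 2)) + m / 4 * u `^ p + N * K * C3 * a `^ p.
  have h3 := H3 _ _ a0 u0.
  have := ler_wpM2l (ltW NK0) h3.
  have -> : N * K * (m / 4 / (N * K) * u `^ p + C3 * a `^ p) =
      m / 4 * u `^ p + N * K * C3 * a `^ p.
    by field; rewrite !gt_eqF.
  have : N * (S * a ^+ 2) <= N * (K * (e `^ (p - 2) + u `^ (p - 2)) * a ^+ 2).
    by rewrite ler_wpM2l ?(ltW N0) // ler_wpM2r ?sqr_ge0.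
  lra.
have hb := H1 _ _ u0 b0.
have hab := H2 _ _ a0 b0.
have ea0 : 0 <= a ^+ 2 * e `^ (p - 2) by rewrite mulr_ge0 ?sqr_ge0 ?powR_ge0.
have ap0 := powR_ge0 a p; have bq0 := powR_ge0 b q.
have t1 : 0 <= (C1 + C2 + N * K) * a `^ p by rewrite mulr_ge0 //; lra.
have t2 : 0 <= (1 + N * K * C3 + N * K) * b `^ q by rewrite mulr_ge0 //; lra.
have t3 : 0 <= (C1 + C2 + 1 + N * K * C3) * (a ^+ 2 * e `^ (p - 2)).
  by rewrite mulr_ge0 //; lra.
have t4 : m * (3 / 4) * u `^ p <= m * (3 / 4) * (S * u ^+ 2).
  by rewrite ler_wpM2l //; lra.
set X := C1 + C2 + 1 + N * K * C3 + N * K.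
have -> : X * (a `^ p + b `^ q + a ^+ 2 * e `^ (p - 2)) =
  (1 + N * K * C3) * a `^ p + (C1 + C2) * b `^ q + N * K * (a ^+ 2 * e `^ (p - 2))
  + (C1 + C2 + N * K) * a `^ p + (1 + N * K * C3 + N * K) * b `^ q
  + (C1 + C2 + 1 + N * K * C3) * (a ^+ 2 * e `^ (p - 2)) by rewrite /X; ring.
rewrite -(mulrA m S).
move: (S * u ^+ 2) (N * (S * a ^+ 2)) hSu hcross t4 hSa => Y Z hSu hcross t4 hSa.
lra.
Qed.

(** * Real interpolation through dyadic level sums *)

Section GeometricSums.
Context (R : realType).
Implicit Types (c e y : R).

(** The sum of the geometric series with ratio [2 `^ (- e)]. *)
Definition geo (e : R) : R := 2 `^ e / (2 `^ e - 1).

Lemma two_powR_gt1 e : 0 < e -> 1 < (2 : R) `^ e.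
Proof.
move=> e0; have : (1 : R) `^ e < 2 `^ e.
  by apply: gt0_ltr_powR => //; rewrite ?nnegrE //; lra.
by rewrite powR1.
Qed.

Lemma geo_ge0 e : 0 < e -> 0 <= geo e.
Proof.
by move=> /two_powR_gt1 h; rewrite divr_ge0 ?powR_ge0 // subr_ge0 ltW.
Qed.

Lemma geo_eq e : 0 < e -> geo e = 1 + geo e / 2 `^ e.
Proof.
move=> /two_powR_gt1 h; rewrite /geo.
have h1 : 2 `^ e - 1 != 0 :> R by rewrite subr_eq0 gt_eqF.
have h2 : 2 `^ e != 0 :> R by rewrite gt_eqF // (lt_trans _ h).
by field; rewrite h1 h2.
Qed.

Lemma geometric_sum_ge c e y N : 0 < c -> 0 < e -> 0 < y ->
  \sum_(i < N) (c * 2 ^+ i) `^ (- e) * (y <= c * 2 ^+ i)%R%:R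
    <= geo e * y `^ (- e).
Proof.
move=> c0 e0 y0; elim: N c c0 => [|N IH] c c0.
  by rewrite big_ord0 mulr_ge0 ?geo_ge0 ?powR_ge0.
have eqs d : \sum_(i < N) (d * 2 ^+ (lift ord0 i)) `^ (- e) *
    (y <= d * 2 ^+ (lift ord0 i))%R%:R =
    \sum_(i < N) (d * 2 * 2 ^+ i) `^ (- e) * (y <= d * 2 * 2 ^+ i)%R%:R.
  by apply: eq_bigr => i _; rewrite /= exprS mulrA.
rewrite big_ord_recl eqs expr0 mulr1.
case: (leP y c) => yc; last first.
  by rewrite mulr0 add0r; apply: IH; rewrite mulr_gt0.
(* Once [c] is above [y] every term counts and the whole series is summed. *)
have all d M : 0 < d -> \sum_(i < M) (d * 2 ^+ i) `^ (- e) <= geo e * d `^ (- e).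
  elim: M d => [|M IHM] d d0.
    by rewrite big_ord0 mulr_ge0 ?geo_ge0 ?powR_ge0.
  rewrite big_ord_recl expr0 mulr1 {1}geo_eq // mulrDl mul1r lerD2l.
  rewrite (_ : _ / _ * _ = geo e * (d * 2) `^ (- e)); last first.
    by rewrite powRM ?(ltW d0) // (powRN 2) -mulrA [X in _ * X]mulrC.
  apply: le_trans (IHM _ _); last by rewrite mulr_gt0.
  by apply: ler_sum => i _; rewrite /= exprS mulrA.
apply: (@le_trans _ _ (geo e * c `^ (- e))).
  apply: le_trans (all _ N.+1 c0).
  rewrite big_ord_recl expr0 mulr1 mulr1 lerD2l.
  apply: ler_sum => i _; rewrite /= exprS mulrA.
  by rewrite ler_piMr ?powR_ge0 // lern1 leq_b1.
rewrite ler_wpM2l ?geo_ge0 // !powRN lef_pV2 ?posrE ?powR_gt0 //.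
by apply: powR_mono => //; exact: ltW.
Qed.

Lemma geometric_sum_lt c e y N : 0 < c -> 0 < e -> 0 <= y ->
  \sum_(i < N) (c * 2 ^+ i) `^ e * (c * 2 ^+ i < y)%R%:R <= geo e * y `^ e.
Proof.
move=> c0 e0 y0; elim: N => [|N IH].
  by rewrite big_ord0 mulr_ge0 ?geo_ge0 ?powR_ge0.
rewrite big_ord_recr /=; case: (ltP (c * 2 ^+ N) y) => yN; last first.
  by rewrite mulr0 addr0.
have all M : \sum_(i < M) (c * 2 ^+ i) `^ e <=
    geo e / 2 `^ e * (c * 2 ^+ M) `^ e.
  elim: M => [|M IHM].
    rewrite big_ord0; apply: mulr_ge0; last exact: powR_ge0.
    by apply: divr_ge0; [exact: geo_ge0 | exact: powR_ge0].
  rewrite big_ord_recr /= exprSr mulrA [in leRHS]powRM ?mulr_ge0 ?exprn_ge0 ?(ltW c0) //.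
  rewrite [leRHS](_ : _ = geo e * (c * 2 ^+ M) `^ e); last first.
    by rewrite mulrACA mulVf ?mulr1 // gt_eqF // powR_gt0.
  by rewrite [in leRHS]geo_eq // mulrDl mul1r addrC lerD2l.
apply: (@le_trans _ _ (geo e * (c * 2 ^+ N) `^ e)).
  rewrite [in leRHS]geo_eq // mulrDl mul1r addrC mulr1 lerD2l.
  apply: le_trans (all N); apply: ler_sum => i _.
  by rewrite ler_piMr ?powR_ge0 // lern1 leq_b1.
rewrite ler_wpM2l ?geo_ge0 // powR_mono ?(ltW e0) ?(ltW yN) //.
by rewrite mulr_ge0 ?exprn_ge0 ?(ltW c0).
Qed.

End GeometricSums.

Section LevelSums.
Context (R : realType) (d : measure_display) (X : measurableType d)
  (mu : {measure set X -> \bar R}).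
Implicit Types (y z : X -> R) (F : R -> R).

Lemma measurable_gt_set z (s : R) : measurable_fun setT z ->
  measurable [set x | s < z x].
Proof.
move=> mz; rewrite (_ : [set x | s < z x] = z @^-1` `]s, +oo[).
  by rewrite -[_ @^-1` _]setTI; exact: mz.
by apply/seteqP; split => x /=; rewrite in_itv /= andbT.
Qed.

Lemma measurable_gt_natr z (s : R) : measurable_fun setT z ->
  measurable_fun setT (fun x => (s < z x)%R%:R : R).
Proof.
move=> mz; rewrite (_ : (fun x => _) = \1_[set x | s < z x]).
  exact/measurable_indic/measurable_gt_set.
by apply/funext => x; rewrite indicE mem_setE.
Qed.

Lemma measurable_le_natr z (s : R) : measurable_fun setT z ->
  measurable_fun setT (fun x => (z x <= s)%R%:R : R).
Proof.
move=> mz; rewrite (_ : (fun x => _) = (fun x => 1 - (s < z x)%R%:R)).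
  apply: measurable_funB => //; exact: measurable_gt_natr.
by apply/funext => x; case: leP => _; rewrite ?subr0 ?subrr.
Qed.

Lemma measurable_powR_fun z (r : R) : measurable_fun setT z ->
  measurable_fun setT (fun x => z x `^ r).
Proof. by move=> mz; exact: (measurableT_comp (measurable_powR r)). Qed.

Lemma measure_gt_integral z (s : R) : measurable_fun setT z ->
  (mu [set x | (s < z x)%R] = \int[mu]_x ((s < z x)%R%:R)%:E)%E.
Proof.
move=> mz; rewrite -[in LHS](setIT [set x | (s < z x)%R]).
rewrite -integral_indic //; last exact: measurable_gt_set.
by apply: eq_integral => x _; rewrite indicE mem_setE.
Qed.

Lemma dyadic_shell (N : nat) (v : R) : (2 ^+ N)^-1 < v -> v <= 2 ^+ N ->
  exists2 i : 'I_(N + N), (2 ^+ N)^-1 * 2 ^+ i < v &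
    v <= (2 ^+ N)^-1 * 2 ^+ i.+1.
Proof.
set c := (2 ^+ N)^-1 => cv vN.
have {}vN : v <= c * 2 ^+ (N + N).
  by rewrite exprD mulrA mulVf ?mul1r // expf_neq0 // pnatr_eq0.
elim: (N + N)%N vN => [|M IH] vM.
  by move: vM; rewrite expr0 mulr1 leNgt cv.
case: (ltP (c * 2 ^+ M) v) => h; first by exists ord_max.
by have [i hi1 hi2] := IH h; exists (widen_ord (leqnSn M) i).
Qed.

(** A layer-cake formula up to constants.  Cutting off at the levels
    [2 ^- N] and [2 ^ N] makes all level sums finite. *)
Lemma integral_le_level_sums z F (D : R) (B : \bar R) :
  measurable_fun setT z -> (forall x, 0 <= z x) ->
  measurable_fun setT (F \o z) ->
  F 0 = 0 -> (forall s t, 0 <= s -> s <= t -> F s <= F t) ->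
  0 <= D -> (forall s, 0 < s -> F (2 * s) <= D * F s) ->
  (forall (c : R) N, (0 < c)%R ->
    (\sum_(i < N) (F (c * 2 ^+ i))%:E * mu [set x | (c * 2 ^+ i < z x)%R]
      <= B)%E) ->
  (\int[mu]_x (F (z x))%:E <= D%:E * B)%E.
Proof.
move=> mz z0 mF F0 Fmono D0 Fdbl HB.
have Fge0 v : 0 <= v -> 0 <= F v by move=> v0; rewrite -F0; exact: Fmono.
pose S (N : nat) := [set x | (2 ^+ N)^-1 < z x] `&` [set x | z x <= 2 ^+ N].
have mS N : measurable (S N).
  apply: measurableI; first exact: measurable_gt_set.
  rewrite (_ : [set x | z x <= 2 ^+ N] = ~` [set x | 2 ^+ N < z x]).
    exact/measurableC/measurable_gt_set.
  by apply/seteqP; split => x /=; rewrite leNgt => /negP.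
have ndS : nondecreasing_seq S.
  apply/nondecreasing_seqP => N; rewrite subsetEset => x [/= h1 h2]; split => /=.
    apply: le_lt_trans h1; rewrite lef_pV2 ?posrE ?exprn_gt0 //.
    by rewrite exprS; have : 0 <= (2 : R) ^+ N by []; lra.
  by apply: le_trans h2 _; rewrite exprS; have : 0 <= (2 : R) ^+ N by []; lra.
have mFz (A : set X) : measurable_fun A (fun x => (F (z x))%:E).
  by apply: measurable_funS (measurableT) _ _ => //; exact/measurable_EFinP.
have bound N : (\int[mu]_(x in S N) (F (z x))%:E <= D%:E * B)%E.
  pose c : R := (2 ^+ N)^-1.
  have c0 : 0 < c by rewrite invr_gt0 exprn_gt0.
  have Fc0 i : 0 <= F (c * 2 ^+ i) by apply: Fge0; rewrite mulr_ge0 ?(ltW c0).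
  apply: (@le_trans _ _ (\int[mu]_x (D%:E * \sum_(i < N + N)
      ((F (c * 2 ^+ i))%:E * ((c * 2 ^+ i < z x)%R%:R)%:E))%E)%E).
    rewrite integral_mkcond; apply: ge0_le_integral => //.
    - by move=> x _; apply: erestrict_ge0 => ? _; rewrite lee_fin Fge0.
    - by apply/(measurable_restrictT _ _).1.
    - apply: emeasurable_funM => //; apply: emeasurable_sum => i.
      apply: emeasurable_funM => //; apply/measurable_EFinP.
      exact: measurable_gt_natr.
    - move=> x _; rewrite patchE; case: ifPn => [|_]; last first.
        rewrite mule_ge0 ?lee_fin // sume_ge0 // => i _.
        by rewrite mule_ge0 ?lee_fin.
      rewrite inE => -[/= h1 h2].
      have [i hi1 hi2] := dyadic_shell h1 h2.
      have ci0 : 0 < c * 2 ^+ i by rewrite mulr_gt0 ?exprn_gt0.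
      apply: (@le_trans _ _ (D%:E * (F (c * 2 ^+ i))%:E)%E).
        rewrite -EFinM lee_fin; apply: le_trans (Fdbl _ ci0).
        by apply: Fmono => //; rewrite mulrCA -exprS.
      rewrite lee_wpmul2l ?lee_fin // (bigD1 i) //= hi1 mule1.
      by rewrite leeDl // sume_ge0 // => j _; rewrite mule_ge0 ?lee_fin.
  rewrite ge0_integralZl ?lee_fin //; last 2 first.
  - apply: emeasurable_sum => i.
    apply: emeasurable_funM => //; apply/measurable_EFinP.
    exact: measurable_gt_natr.
  - by move=> x _; rewrite sume_ge0 // => i _; rewrite mule_ge0 ?lee_fin.
  rewrite lee_wpmul2l ?lee_fin //.
  rewrite ge0_integral_sum //; last 2 first.
  - move=> i; apply: emeasurable_funM => //; apply/measurable_EFinP.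
    exact: measurable_gt_natr.
  - by move=> i x _; rewrite mule_ge0 ?lee_fin.
  apply: le_trans (HB c (N + N)%N c0); apply: lee_sum => i _.
  rewrite ge0_integralZl ?lee_fin //; last first.
  - by apply/measurable_EFinP; exact: measurable_gt_natr.
  by rewrite measure_gt_integral.
have -> : (\int[mu]_x (F (z x))%:E =
           \int[mu]_(x in \bigcup_i S i) (F (z x))%:E)%E.
  rewrite [RHS]integral_mkcond; apply: eq_integral => x _.
  rewrite patchE; case: ifPn => // /negP; rewrite inE => nS.
  have [zx|zx] := ltP 0 (z x); last first.
    by rewrite (_ : z x = 0) ?F0 //; apply/eqP; rewrite eq_le zx z0.
  exfalso; apply: nS.
  pose M := maxn (Num.Def.archi_bound (z x)^-1) (Num.Def.archi_bound (z x)).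
  have lt2 (n : nat) (v : R) : 0 <= v -> (Num.Def.archi_bound v <= n)%N -> v < 2 ^+ n.
    move=> v0 vn; apply: lt_le_trans (archi_boundP v0) _.
    rewrite -natrX ler_nat; apply: leq_trans vn _; apply: ltnW.
    exact: ltn_expl.
  exists M => //; split => /=.
    rewrite invf_plt ?posrE ?exprn_gt0 //.
    by apply: lt2; rewrite ?invr_ge0 // leq_maxl.
  by apply/ltW/lt2 => //; rewrite leq_maxr.
have cv : (\int[mu]_(x in S N) (F (z x))%:E @[N --> \oo] -->
    \int[mu]_(x in \bigcup_i S i) (F (z x))%:E)%E.
  by apply: ge0_nondecreasing_set_cvg_integral => // i x _; rewrite lee_fin Fge0.
rewrite -(cvg_lim _ cv) //.
apply: lime_le; first by apply/cvg_ex; eexists; exact: cv.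
by apply: nearW => N; exact: bound.
Qed.

End LevelSums.

Section Interpolation.
Context (R : realType) (d : measure_display) (X : measurableType d)
  (mu : {measure set X -> \bar R}).
Implicit Types (y z : X -> R).

(** Kolmogorov's inequality for a weak-type bound with exponent [l]: the
    integrand grows faster than [l] below the level [t] and more slowly above
    it, so both halves of the level sum are geometric series dominated by the
    term at [t]. *)
Lemma weak_type_integral_min (g l k : R) : 0 <= g -> g < l -> l < k ->
  exists2 C : R, 0 <= C & forall z (W : \bar R) (t : R),
    measurable_fun setT z -> (forall x, 0 <= z x) -> (0 <= W)%E -> 0 < t ->
    (forall s, 0 < s -> (mu [set x | (s < z x)%R] <= (s `^ (- l))%:E * W)%E) ->
    (\int[mu]_x (Num.min (t `^ (1 - g) * z x `^ g) (t `^ (1 - k) * z x `^ k))%:E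
      <= (C * t `^ (1 - l))%:E * W)%E.
Proof.
move=> g0 gl lk.
have k0 : 0 < k by lra.
have kl : 0 < k - l by lra.
have lg : 0 < l - g by lra.
have geo0 : 0 <= geo (k - l) + geo (l - g) by rewrite addr_ge0 ?geo_ge0.
exists (2 `^ k * (geo (k - l) + geo (l - g))).
  by rewrite mulr_ge0 ?powR_ge0.
move=> z W t mz z0 W0 t0 weak.
pose F (v : R) := Num.min (t `^ (1 - g) * v `^ g) (t `^ (1 - k) * v `^ k).
have F0 v : 0 <= F v by rewrite le_min !mulr_ge0 ?powR_ge0.
rewrite -mulrA EFinM -muleA.
apply: (@integral_le_level_sums _ _ _ mu z F) => //.
- apply: measurable_minr; apply: measurable_funM => //;
    exact: measurable_powR_fun.
- rewrite /F (powR0 (lt0r_neq0 k0)) mulr0; apply/min_idPr.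
  by rewrite mulr_ge0 ?powR_ge0.
- move=> s u s0 su; rewrite le_min !ge_min; apply/andP; split; apply/orP.
    by left; rewrite ler_wpM2l ?powR_ge0 ?powR_mono.
  by right; rewrite ler_wpM2l ?powR_ge0 ?powR_mono ?(ltW k0).
- move=> s s0; rewrite /F !powRM ?(ltW s0) //.
  rewrite minr_pMr ?powR_ge0 // [t `^ (1 - g) * _]mulrCA [t `^ (1 - k) * _]mulrCA.
  rewrite le_min !ge_min; apply/andP; split; apply/orP; [left|right].
    rewrite ler_wpM2r ?mulr_ge0 ?powR_ge0 //.
    by apply: ler_powR; lra.
  exact: lexx.
move=> c N c0.
have c2 i : 0 < c * 2 ^+ i by rewrite mulr_gt0 ?exprn_gt0.
apply: (@le_trans _ _
  (\sum_(i < N) ((F (c * 2 ^+ i) * (c * 2 ^+ i) `^ (- l))%:E * W))%E).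
  apply: lee_sum => i _; rewrite EFinM -muleA lee_wpmul2l ?lee_fin //.
  exact: weak.
rewrite -ge0_sume_distrl; last first.
  by move=> i _; rewrite lee_fin mulr_ge0 ?powR_ge0.
rewrite lee_wpmul2r // sumEFin lee_fin.
apply: (@le_trans _ _ (t `^ (1 - k) * (geo (k - l) * t `^ (k - l)) +
                       t `^ (1 - g) * (geo (l - g) * t `^ (- (l - g))))).
  apply: le_trans (lerD (ler_wpM2l (powR_ge0 _ _)
      (geometric_sum_lt N c0 kl (ltW t0)))
    (ler_wpM2l (powR_ge0 _ _) (geometric_sum_ge N c0 lg t0))).
  rewrite !mulr_sumr -big_split /=; apply: ler_sum => i _.
  have pD (r s : R) : (c * 2 ^+ i) `^ r * (c * 2 ^+ i) `^ s =
      (c * 2 ^+ i) `^ (r + s).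
    by rewrite powRD // (gt_eqF (c2 i)) implybT.
  have H (e e' r : R) : r = e - l -> F (c * 2 ^+ i) <= e' * (c * 2 ^+ i) `^ e ->
      F (c * 2 ^+ i) * (c * 2 ^+ i) `^ (- l) <= e' * (c * 2 ^+ i) `^ r.
    by move=> -> h; rewrite -pD mulrA ler_wpM2r ?powR_ge0.
  case: (ltP (c * 2 ^+ i) t) => h; rewrite !(mulr1, mulr0, addr0, add0r).
    by apply: (H k) => //; rewrite /F ge_min lexx orbT.
  by apply: (H g); [ring | rewrite /F ge_min lexx].
rewrite ![t `^ _ * (_ * t `^ _)]mulrCA -!powRD ?(gt_eqF t0) ?implybT //.
have -> : 1 - k + (k - l) = 1 - l by ring.
have -> : 1 - g - (l - g) = 1 - l by ring.
by rewrite -mulrDl.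
Qed.

Lemma ge0_integral_lin2 (r a b : R) (f g : X -> R) :
  0 <= r -> 0 <= a -> 0 <= b ->
  measurable_fun setT f -> measurable_fun setT g ->
  (forall x, 0 <= f x) -> (forall x, 0 <= g x) ->
  (\int[mu]_x (r * (a * f x + b * g x))%:E =
    r%:E * (a%:E * \int[mu]_x (f x)%:E + b%:E * \int[mu]_x (g x)%:E))%E.
Proof.
move=> r0 a0 b0 mf mg f0 g0.
have mE (h : X -> R) : measurable_fun setT h ->
    measurable_fun setT (fun x => (h x)%:E) by move=> ?; exact/measurable_EFinP.
have maf : measurable_fun setT (fun x => a * f x) by exact: measurable_funM.
have mbg : measurable_fun setT (fun x => b * g x) by exact: measurable_funM.
under eq_integral do rewrite EFinM.
rewrite ge0_integralZl ?lee_fin //; last 2 first.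
- by apply: mE; exact: measurable_funD.
- by move=> x _; rewrite lee_fin addr_ge0 // mulr_ge0.
congr (_ * _)%E.
under eq_integral do rewrite EFinD.
rewrite ge0_integralD //; [|by move=> x _; rewrite lee_fin mulr_ge0|exact: mE
  |by move=> x _; rewrite lee_fin mulr_ge0|exact: mE].
under eq_integral do rewrite EFinM.
rewrite ge0_integralZl ?lee_fin //; [|exact: mE|by move=> x _; rewrite lee_fin].
congr (_ + _)%E.
under eq_integral do rewrite EFinM.
by rewrite ge0_integralZl ?lee_fin //; [exact: mE|move=> x _; rewrite lee_fin].
Qed.

(** The interpolation principle in the form needed for nonlinear operators:
    only a bound of the distribution function of [z] by the two truncations of
    [y] at each level enters, wherever it comes from. *)
Lemma interpolation (l tau k K C : R) :
  0 < l -> l < tau -> tau < k -> 0 < K -> 0 <= C ->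
  exists2 C' : R, 0 <= C' & forall y z,
    measurable_fun setT y -> measurable_fun setT z ->
    (forall x, 0 <= y x) -> (forall x, 0 <= z x) ->
    (forall t, 0 < t -> (mu [set x | (K * t < z x)%R] <=
       C%:E * ((t `^ (- l))%:E * \int[mu]_x (y x `^ l * (t < y x)%R%:R)%:E +
               (t `^ (- k))%:E * \int[mu]_x (y x `^ k * (y x <= t)%R%:R)%:E))%E) ->
    (\int[mu]_x (z x `^ tau)%:E <= C'%:E * \int[mu]_x (y x `^ tau)%:E)%E.
Proof.
move=> l0 lt tk K0 C0.
have tau0 : 0 < tau by lra.
have tl0 : 0 < tau - l by lra.
have kt0 : 0 < k - tau by lra.
pose G : R := K `^ tau * C * (geo (tau - l) + geo (k - tau)).
have G0 : 0 <= G by rewrite !mulr_ge0 ?addr_ge0 ?geo_ge0 ?powR_ge0.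
exists (2 `^ tau * G); first by rewrite mulr_ge0 ?powR_ge0.
move=> y z my mz y0 z0 dist.
rewrite EFinM -muleA.
apply: (@integral_le_level_sums _ _ _ mu z (@powR R ^~ tau)) => //.
- exact: measurable_powR_fun.
- by rewrite powR0 // gt_eqF.
- by move=> s t s0 st; rewrite powR_mono // ltW.
- by move=> s s0; rewrite powRM // ltW.
move=> c N c0; pose b := c / K.
have b0 : 0 < b by rewrite divr_gt0.
have cE i : c * 2 ^+ i = K * (b * 2 ^+ i) by rewrite /b; field; rewrite gt_eqF.
have b2 i : 0 < b * 2 ^+ i by rewrite mulr_gt0 ?exprn_gt0.
pose h i x : R := K `^ tau * C *
  ((b * 2 ^+ i) `^ (tau - l) * (y x `^ l * (b * 2 ^+ i < y x)%R%:R) +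
   (b * 2 ^+ i) `^ (- (k - tau)) * (y x `^ k * (y x <= b * 2 ^+ i)%R%:R)).
have h0 i x : 0 <= h i x.
  by rewrite !(mulr_ge0, addr_ge0) ?powR_ge0.
have mlt i : measurable_fun setT (fun x => y x `^ l * (b * 2 ^+ i < y x)%R%:R).
  apply: measurable_funM; [exact: measurable_powR_fun|].
  exact: measurable_gt_natr.
have mge i : measurable_fun setT (fun x => y x `^ k * (y x <= b * 2 ^+ i)%R%:R).
  apply: measurable_funM; [exact: measurable_powR_fun|].
  exact: measurable_le_natr.
have mh i : measurable_fun setT (h i).
  apply: measurable_funM => //; apply: measurable_funD; exact: measurable_funM.
apply: (@le_trans _ _ (\sum_(i < N) \int[mu]_x (h i x)%:E)%E).
  apply: lee_sum => i _.
  rewrite cE powRM ?(ltW K0) ?(ltW (b2 i)) //.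
  apply: le_trans (lee_wpmul2l _ (dist _ (b2 i))) _.
    by rewrite lee_fin mulr_ge0 ?powR_ge0.
  rewrite ge0_integral_lin2 ?mulr_ge0 ?powR_ge0 //; last 2 first.
  - by move=> x; rewrite mulr_ge0 ?powR_ge0.
  - by move=> x; rewrite mulr_ge0 ?powR_ge0.
  have pD (r s : R) : (b * 2 ^+ i) `^ (r + s) =
      (b * 2 ^+ i) `^ r * (b * 2 ^+ i) `^ s.
    by rewrite powRD // (gt_eqF (b2 i)) implybT.
  rewrite opprB !pD.
  set u := (b * 2 ^+ i) `^ tau.
  have u0 : 0 <= u by exact: powR_ge0.
  set I := (\int[mu]_x (y x `^ l * _)%:E)%E.
  set J := (\int[mu]_x (y x `^ k * _)%:E)%E.
  have I0 : (0 <= I)%E.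
    by apply: integral_ge0 => x _; rewrite lee_fin mulr_ge0 ?powR_ge0.
  have J0 : (0 <= J)%E.
    by apply: integral_ge0 => x _; rewrite lee_fin mulr_ge0 ?powR_ge0.
  rewrite !EFinM -!muleA -ge0_muleDr ?mule_ge0 ?lee_fin ?powR_ge0 //.
  by rewrite [(u%:E * (C%:E * _))%E]muleCA.
rewrite -ge0_integral_sum //; last 2 first.
- by move=> i; exact/measurable_EFinP.
- by move=> i x _; rewrite lee_fin.
rewrite -ge0_integralZl ?lee_fin //; last 2 first.
- by apply/measurable_EFinP; exact: measurable_powR_fun.
- by move=> x _; rewrite lee_fin powR_ge0.
apply: ge0_le_integral => //.
- by move=> x _; rewrite sume_ge0 // => i _; rewrite lee_fin.
- by apply: emeasurable_sum => i; exact/measurable_EFinP.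
- apply/measurable_EFinP; apply: measurable_funM => //.
  exact: measurable_powR_fun.
move=> x _; rewrite sumEFin -EFinM lee_fin -mulr_sumr -[G * _]mulrA.
rewrite ler_wpM2l ?mulr_ge0 ?powR_ge0 //.
have [yx|yx] := ltP 0 (y x); last first.
  have yx0 : y x = 0 by apply/eqP; rewrite eq_le yx y0.
  rewrite yx0 (powR0 (lt0r_neq0 l0)) (powR0 (lt0r_neq0 (lt_trans tau0 tk))).
  rewrite (powR0 (lt0r_neq0 tau0)) mulr0 big1 // => i _.
  by rewrite !mul0r !mulr0 addr0.
have pD (r s : R) : y x `^ r * y x `^ s = y x `^ (r + s).
  by rewrite powRD // (gt_eqF yx) implybT.
rewrite big_split /= mulrDl; apply: lerD.
  rewrite (_ : y x `^ tau = y x `^ (tau - l) * y x `^ l); last first.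
    by rewrite pD subrK.
  rewrite mulrA; apply: le_trans (ler_wpM2r (powR_ge0 _ _)
    (geometric_sum_lt N b0 tl0 (y0 x))).
  rewrite mulr_suml; apply: ler_sum => i _.
  by rewrite -!mulrA [y x `^ l * _]mulrC.
rewrite (_ : y x `^ tau = y x `^ (- (k - tau)) * y x `^ k); last first.
  by rewrite pD; congr powR; ring.
rewrite mulrA; apply: le_trans (ler_wpM2r (powR_ge0 _ _)
  (geometric_sum_ge N b0 kt0 yx)).
rewrite mulr_suml; apply: ler_sum => i _.
by rewrite -!mulrA [y x `^ k * _]mulrC.
Qed.

End Interpolation.

(** * Measurability in a finite dimensional inner product space *)

Section InnerProduct.
Context (R : realType) (V : normedVectType R) (ip : {dot V for idfun}).
Hypothesis ip_norm : induces_norm ip.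
Implicit Types u v w : V.

Lemma ipC u v : ip u v = ip v u.
Proof. by rewrite hermC expr0 mul1r. Qed.

Lemma ipBl u v w : ip (u - v) w = ip u w - ip v w.
Proof. exact: linearBl. Qed.

Lemma ipBr u v w : ip w (u - v) = ip w u - ip w v.
Proof. exact: linearBr. Qed.

Lemma ipZl (c : R) u v : ip (c *: u) v = c * ip u v.
Proof. exact: linearZl_LR. Qed.

Lemma ipZr (c : R) u v : ip u (c *: v) = c * ip u v.
Proof. by rewrite ipC ipZl ipC. Qed.

Lemma ip_sub_sqr u v : `|u - v| ^+ 2 = `|u| ^+ 2 + `|v| ^+ 2 - 2 * ip u v.
Proof. by rewrite !ip_norm ipBl !ipBr (ipC v u); ring. Qed.

Lemma ip_polarization u v :
  ip u v = (`|u| ^+ 2 + `|v| ^+ 2 - `|u - v| ^+ 2) / 2.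
Proof. by rewrite ip_sub_sqr; field. Qed.

Lemma norm_ip_le u v : `|ip u v| <= `|u| * `|v|.
Proof.
have [->|v0] := eqVneq v 0; first by rewrite linear0r !normr0 mulr0.
have nv : 0 < `|v| by rewrite normr_gt0.
have key : ip u v ^+ 2 <= (`|u| * `|v|) ^+ 2.
  rewrite exprMn.
  have := sqr_ge0 `|(`|v| ^+ 2) *: u - ip u v *: v|.
  rewrite [`|_ - _| ^+ 2]ip_norm ipBl !ipBr !ipZl !ipZr -!ip_norm (ipC v u) => h.
  have {}h : 0 <= `|v| ^+ 2 * (`|u| ^+ 2 * `|v| ^+ 2 - ip u v ^+ 2).
    apply: le_trans h _; rewrite le_eqVlt; apply/orP; left; apply/eqP.
    by ring.
  by rewrite pmulr_rge0 ?exprn_gt0 // subr_ge0 in h.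
rewrite -(@ler_pXn2r _ 2) ?nnegrE ?mulr_ge0 //.
by rewrite -normrX ger0_norm ?sqr_ge0.
Qed.

End InnerProduct.

Section DenseSequence.
Context (R : realType) (V : normedVectType R).

(** A witness of separability: [unpickle] runs through the rational coefficient
    vectors with respect to a basis. *)
Definition rat_comb (k : nat) : V :=
  let b := vbasis {:V}%VS in
  if @unpickle {ffun 'I_(\dim {:V}%VS) -> rat} k is Some c
  then \sum_i (ratr (c i) : R) *: b`_i else 0.

Lemma rat_comb_dense (v : V) (e : R) : 0 < e -> exists k, `|v - rat_comb k| < e.
Proof.
move=> e0; set n := \dim {:V}%VS; set b := vbasis {:V}%VS.
pose S : R := 1 + \sum_(i < n) `|b`_i|.
have S0 : 0 < S by rewrite ltr_pwDl // sumr_ge0.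
pose dl := e / S.
have dl0 : 0 < dl by rewrite divr_gt0.
have [c hc] : exists c : {ffun 'I_n -> rat},
    forall i, `|coord b i v - ratr (c i)| < dl.
  have h i : exists q : rat, `|coord b i v - ratr q| < dl.
    have [|q] := @rat_in_itvoo R (coord b i v - dl) (coord b i v); first by lra.
    by rewrite in_itv /= => hq; exists q; rewrite ltr_norml; lra.
  exists [ffun i => projT1 (cid (h i))] => i; rewrite ffunE.
  by case: (cid (h i)).
exists (pickle c); rewrite /rat_comb pickleK.
rewrite {1}(coord_vbasis (memvf v)) -/b -sumrB.
apply: le_lt_trans (ler_norm_sum _ _ _) _.
apply: (@le_lt_trans _ _ (\sum_(i < n) dl * `|b`_i|)).
  apply: ler_sum => i _; rewrite -scalerBl normrZ ler_wpM2r //.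
  exact/ltW/hc.
rewrite -mulr_sumr /dl -mulrA gtr_pMr // mulrC ltr_pdivrMr // mul1r /S.
by rewrite ltrDr.
Qed.

End DenseSequence.

Lemma subr_interchange (M : zmodType) (a b c e : M) :
  a - b - (c - e) = (a - c) - (b - e).
Proof. by rewrite !opprB addrACA [RHS]addrACA [- _ - _]addrC. Qed.

Section VMeasurable.
Context (R : realType) (d : measure_display) (X : measurableType d)
  (V : normedVectType R).
Implicit Types (f g : X -> V).

Lemma vmeasurable_cst (v : V) : vmeasurable (fun _ : X => v).
Proof.
move=> U _; case: (pselect (U v)) => Uv.
  rewrite (_ : _ @^-1` _ = setT); first exact: measurableT.
  by apply/seteqP; split.
rewrite (_ : _ @^-1` _ = set0); first exact: measurable0.
by apply/seteqP; split.
Qed.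

(** Here separability enters: the preimage of an open set under [f - g] is a
    countable union of rectangles over balls centred in the dense sequence. *)
Lemma vmeasurableB f g : vmeasurable f -> vmeasurable g ->
  vmeasurable (fun x => f x - g x).
Proof.
move=> mf mg U oU.
pose r (k : nat) : R := k.+1%:R^-1.
have r0 k : 0 < r k by rewrite invr_gt0 ltr0n.
pose P m n k := forall w : V, `|rat_comb V m - rat_comb V n - w| < 2 * r k -> U w.
pose Q m n k := if `[< P m n k >] then
  f @^-1` ball (rat_comb V m) (r k) `&` g @^-1` ball (rat_comb V n) (r k)
  else set0.
rewrite (_ : _ @^-1` U = \bigcup_m \bigcup_n \bigcup_k Q m n k).
  apply: bigcup_measurable => m _; apply: bigcup_measurable => n _.
  apply: bigcup_measurable => k _; rewrite /Q; case: asboolP => // _.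
  by apply: measurableI; [apply: mf | apply: mg]; exact: ball_open.
apply/seteqP; split => [x /= Ux|x [m _ [n _ [k _]]]]; last first.
  rewrite /Q; case: asboolP => // Pmnk [/= fx gx]; apply: Pmnk.
  rewrite -ball_normE /= in fx; rewrite -ball_normE /= in gx.
  rewrite (_ : _ - _ - _ = (rat_comb V m - f x) - (rat_comb V n - g x)).
    by apply: le_lt_trans (ler_normB _ _) _; lra.
  by rewrite subr_interchange.
have /nbhs_ballP[e /= e0 he] := open_nbhs_nbhs (conj oU Ux).
have [k hk] : exists k, 4 * r k < e.
  exists (Num.Def.archi_bound (4 / e)).
  rewrite /r ltr_pdivrMr ?ltr0n // mulrC -ltr_pdivrMr //.
  have h4 : 0 <= 4 / e by rewrite divr_ge0 // ltW.
  by apply: lt_le_trans (archi_boundP h4) _; rewrite ler_nat.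
have [m hm] := rat_comb_dense (f x) (r0 k).
have [n hn] := rat_comb_dense (g x) (r0 k).
exists m => //; exists n => //; exists k => //.
rewrite /Q; case: asboolP => [_|[]].
  by split; rewrite /= -ball_normE /= distrC.
move=> w hw; apply: he; rewrite -ball_normE /=.
rewrite (_ : f x - g x - w = (f x - rat_comb V m) - (g x - rat_comb V n) +
  (rat_comb V m - rat_comb V n - w)).
  apply: le_lt_trans (ler_normD _ _) _.
  have := ler_normB (f x - rat_comb V m) (g x - rat_comb V n); lra.
by rewrite subr_interchange addrA subrK.
Qed.

Lemma vmeasurableD f g : vmeasurable f -> vmeasurable g ->
  vmeasurable (fun x => f x + g x).
Proof.
move=> mf mg; have := vmeasurableB mf (vmeasurableB (vmeasurable_cst 0) mg).
by rewrite (_ : (fun x => _) = (fun x => f x + g x)) //;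
  apply/funext => x; rewrite sub0r opprK.
Qed.

Lemma vmeasurable_if (P : X -> bool) f g : measurable_fun setT P ->
  vmeasurable f -> vmeasurable g ->
  vmeasurable (fun x => if P x then f x else g x).
Proof.
move=> mP mf mg U oU.
have mT : measurable [set x | P x].
  by rewrite -[X in measurable X]setTI; exact: (mP measurableT [set true]).
rewrite (_ : _ @^-1` U =
  ([set x | P x] `&` f @^-1` U) `|` (~` [set x | P x] `&` g @^-1` U)).
  apply: measurableU; first by apply: measurableI => //; exact: mf.
  by apply: measurableI; [exact: measurableC | exact: mg].
apply/seteqP; split => x /=.
  case: ifPn => [Px Uf|/negP Px Ug]; first by left.
  by right.
by move=> [[-> //]|[/negP/negbTE ->]].
Qed.

Lemma measurable_norm_vmeasurable f : vmeasurable f ->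
  measurable_fun setT (fun x => `|f x|).
Proof.
move=> mf; apply: (measurability _ (RGenOpens.measurableE R)).
move=> _ [_ [a [b ->] <-]]; rewrite setTI.
apply: (mf ((fun v : V => `|v|) @^-1` `]a, b[)); apply: open_comp.
  by move=> v _; exact: norm_continuous.
exact: interval_open.
Qed.

Lemma measurable_ip (ip : {dot V for idfun}) f g : induces_norm ip ->
  vmeasurable f -> vmeasurable g ->
  measurable_fun setT (fun x => ip (f x) (g x)).
Proof.
move=> ipn mf mg.
rewrite (_ : (fun x => _) = (fun x =>
  (`|f x| ^+ 2 + `|g x| ^+ 2 - `|f x - g x| ^+ 2) * 2^-1)); last first.
  by apply/funext => x; rewrite ip_polarization.
apply: measurable_funM => //; apply: measurable_funB.
  by apply: measurable_funD; apply: measurable_funX;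
    exact: measurable_norm_vmeasurable.
apply: measurable_funX; apply: measurable_norm_vmeasurable.
exact: vmeasurableB.
Qed.

End VMeasurable.

(** * Orthogonality of the closed subspaces and the energy estimate *)

Section Energy.
Context (R : realType) (d : measure_display) (X : measurableType d)
  (mu : {measure set X -> \bar R}) (V : normedVectType R)
  (ip : {dot V for idfun}).
Hypothesis ip_norm : induces_norm ip.
Implicit Types (f g a b : X -> V) (P : X -> bool).

Lemma hoelder_ip (p q : R) f g : 0 < p -> 0 < q -> p^-1 + q^-1 = 1 ->
  vmeasurable f -> vmeasurable g ->
  (\int[mu]_x `|(ip (f x) (g x))%:E| <=
   Lnorm mu p%:E (fun x => `|f x|%:E) * Lnorm mu q%:E (fun x => `|g x|%:E))%E.
Proof.
move=> p0 q0 pq mf mg.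
have mnf := measurable_norm_vmeasurable mf.
have mng := measurable_norm_vmeasurable mg.
apply: le_trans (hoelder mu mnf mng p0 q0 pq); rewrite Lnorm1.
apply: ge0_le_integral => //.
- apply: measurableT_comp => //; apply/measurable_EFinP.
  exact: measurable_ip.
- apply: measurableT_comp => //; apply/measurable_EFinP.
  exact: measurable_funM.
- move=> x _; rewrite /= lee_fin [leRHS]ger0_norm ?mulr_ge0 //.
  exact: norm_ip_le.
Qed.

Definition null_integral (h : X -> R) : Prop :=
  mu.-integrable setT (EFin \o h) /\ (\int[mu]_x (h x)%:E = 0)%E.

Lemma null_integralB (h1 h2 : X -> R) : null_integral h1 -> null_integral h2 ->
  null_integral (fun x => h1 x - h2 x).
Proof.
move=> [i1 e1] [i2 e2]; split.
  exact: (integrableB measurableT i1 i2).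
under eq_integral do rewrite EFinB.
by rewrite (integralB_EFin measurableT i1 i2) e1 e2 sube0.
Qed.

(** Approximating first [a] in the norm of L^p, then [b] in that of L^q, to an
    accuracy that depends on the approximant of [a], makes both error terms
    small by Hoelder's inequality. *)
Lemma orthogonal_closures (p q : R) (H : set (X -> V)) a b :
  0 < p -> 0 < q -> p^-1 + q^-1 = 1 ->
  Lclosure mu p%:E H a -> Lclosure mu q%:E (orthoL2 mu ip H) b ->
  null_integral (fun x => ip (b x) (a x)).
Proof.
move=> p0 q0 pq [[ma fa] Ha] [[mb fb] Hb].
pose N (r : R) f := Lnorm mu r%:E (fun x => `|f x|%:E).
have N0 r f : (0 <= N r f)%E by exact: Lnorm_ge0.
have finN r f : (N r f < +oo)%E -> N r f = (fine (N r f))%:E.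
  by move=> h; rewrite fineK // ge0_fin_numE.
have qp : q^-1 + p^-1 = 1 by rewrite addrC.
have mip f g : vmeasurable f -> vmeasurable g ->
    measurable_fun setT (fun x => (ip (f x) (g x))%:E).
  by move=> mf mg; apply/measurable_EFinP; exact: measurable_ip.
have int f g : vmeasurable f -> vmeasurable g -> (N q f < +oo)%E ->
    (N p g < +oo)%E -> mu.-integrable setT (EFin \o (fun x => ip (f x) (g x))).
  move=> mf mg Nf Ng; apply/integrableP; split; first exact: mip.
  apply: le_lt_trans (hoelder_ip q0 p0 qp mf mg) _.
  by rewrite -/(N q f) -/(N p g) (finN _ _ Nf) (finN _ _ Ng) -EFinM ltry.
have bnd f g : vmeasurable f -> vmeasurable g ->
    (`|\int[mu]_x (ip (f x) (g x))%:E| <= N q f * N p g)%E.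
  move=> mf mg; apply: le_trans (le_abse_integral mu measurableT (mip _ _ mf mg)) _.
  exact: hoelder_ip.
have iba := int _ _ mb ma fb fa.
split; first exact: iba.
set I := (\int[mu]_x _)%E.
have I_small (e : R) : 0 < e -> (`|I| <= e%:E)%E.
  move=> e0.
  set B := fine (N q b); have B0 : 0 <= B by exact: fine_ge0.
  have e10 : 0 < e / 2 / (B + 1) by rewrite !divr_gt0 //; lra.
  have [g [Hg [mg fg]] dg] := Ha _ e10.
  set G := fine (N p g); have G0 : 0 <= G by exact: fine_ge0.
  have e20 : 0 < e / 2 / (G + 1) by rewrite !divr_gt0 //; lra.
  have [k [[_ Hk] [mk fk]] dk] := Hb _ e20.
  have mag := vmeasurableB ma mg; have mbk := vmeasurableB mb mk.
  have fag : (N p (fun x => (a x - g x)%R) < +oo)%E by exact: lt_trans dg (ltry _).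
  have fbk : (N q (fun x => (b x - k x)%R) < +oo)%E by exact: lt_trans dk (ltry _).
  have i1 := int _ _ mb mag fb fag.
  have i2 := int _ _ mbk mg fbk fg.
  have i3 := int _ _ mk mg fk fg.
  have -> : I = (\int[mu]_x (ip (b x) (a x - g x)%R)%:E +
                 \int[mu]_x (ip (b x - k x)%R (g x))%:E)%E.
    rewrite -[RHS]adde0 -(Hk g Hg).
    rewrite -(integralD_EFin measurableT i1 i2).
    rewrite -(integralD_EFin measurableT (integrableD measurableT i1 i2) i3).
    by apply: eq_integral => x _; rewrite /= -!EFinD ipBr ipBl addrA !subrK.
  apply: le_trans (lee_abs_add _ _) _.
  rewrite (_ : e%:E = (e / 2)%:E + (e / 2)%:E)%E; last first.
    by rewrite -EFinD; congr EFin; field.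
  apply: leeD.
    apply: le_trans (bnd _ _ mb mag) _; rewrite (finN _ _ fb) (finN _ _ fag).
    rewrite -EFinM lee_fin -/B; apply: (@le_trans _ _ (B * (e / 2 / (B + 1)))).
      rewrite ler_wpM2l // -lee_fin -finN //; exact: ltW.
    by rewrite mulrCA ler_piMr //; [lra | rewrite ler_pdivrMr; lra].
  apply: le_trans (bnd _ _ mbk mg) _; rewrite (finN _ _ fbk) (finN _ _ fg).
  rewrite -EFinM lee_fin -/G; apply: (@le_trans _ _ (e / 2 / (G + 1) * G)).
    rewrite ler_wpM2r // -lee_fin -finN //; exact: ltW.
  by rewrite -mulrA ler_piMr //; [lra | rewrite mulrC ler_pdivrMr; lra].
apply/eqP; rewrite -abse_eq0 eq_le abse_ge0 andbT.
by apply/lee_addgt0Pr => e e0; rewrite add0e; exact: I_small.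
Qed.

Definition off P f (x : X) : V := if P x then 0 else f x.

Lemma subr_off P f x : f x - off P f x = if P x then f x else 0.
Proof. by rewrite /off; case: ifP => _; rewrite ?subr0 ?subrr. Qed.

Lemma vmeasurable_off P f : measurable_fun setT P -> vmeasurable f ->
  vmeasurable (off P f).
Proof. by move=> mP mf; apply: vmeasurable_if => //; exact: vmeasurable_cst. Qed.

Definition off2 P (F : (X -> V) * (X -> V)) : (X -> V) * (X -> V) :=
  (off P F.1, off P F.2).

Lemma off2_bracket p q P F x : p != 0 -> q != 0 ->
  bracket p q (off2 P F) x = bracket p q F x * (~~ P x)%:R.
Proof.
move=> p0 q0; rewrite /bracket /= /off; case: (P x) => /=.
  by rewrite !normr0 !powR0 // addr0 mulr0.
by rewrite mulr1.
Qed.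

Lemma measurable_bracket p q (F : (X -> V) * (X -> V)) :
  vmeasurable F.1 -> vmeasurable F.2 ->
  measurable_fun setT (bracket p q F).
Proof.
move=> m1 m2; apply: measurable_funD; apply: measurable_powR_fun;
  exact: measurable_norm_vmeasurable.
Qed.

Lemma bracket_ge0 p q (F : (X -> V) * (X -> V)) x : 0 <= bracket p q F x.
Proof. by rewrite addr_ge0 ?powR_ge0. Qed.

Context (p q L m : R) (A : X -> V -> V) (H : set (X -> V)).
Hypotheses (p_ge2 : 2 <= p) (q_gt0 : 0 < q) (pq_conj : p^-1 + q^-1 = 1).
Hypotheses (L_gt0 : 0 < L) (m_gt0 : 0 < m).
Hypothesis A_struct : structure_conditions mu ip p L m A.

(** The energy estimate.  The differences of the two solutions are orthogonal;
    monotonicity of the field turns this into a bound for the distance of the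
    two points [F.1 + phi.1] and [off P F.1 + psi.1], with an error supported
    where the data have been removed.  The values of the field are replaced by
    [F.2 + phi.2] and [off P F.2 + psi.2], whose measurability is known. *)
Lemma energy_estimate : exists2 C : R, 0 <= C & forall P F phi psi,
  measurable_fun setT P -> vmeasurable F.1 -> vmeasurable F.2 ->
  solves mu ip p q A H F phi -> solves mu ip p q A H (off2 P F) psi ->
  (\int[mu]_x (`|F.1 x + phi.1 x - (off P F.1 x + psi.1 x)| `^ p)%:E <=
   C%:E * \int[mu]_x ((P x)%:R * (bracket p q F x +
      `|F.1 x| ^+ 2 * `|psi.1 x| `^ (p - 2)))%:E)%E.
Proof.
have [_ _ _ A_lip A_mono] := A_struct.
have p_gt0 : 0 < p by exact: lt_le_trans p_ge2.
have [C C0 HC] := absorption p_ge2 q_gt0 pq_conj m_gt0 L_gt0.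
exists (4 / m * C); first by rewrite mulr_ge0 // divr_ge0 // ltW.
move=> P F phi psi mP mF1 mF2 [phi1 phi2 phiA] [psi1 psi2 psiA].
pose W x := ip (phi.2 x - psi.2 x) (phi.1 x - psi.1 x).
have [iW W0] : null_integral W.
  have -> : W = fun x => (ip (phi.2 x) (phi.1 x) - ip (psi.2 x) (phi.1 x)) -
      (ip (phi.2 x) (psi.1 x) - ip (psi.2 x) (psi.1 x)).
    by apply/funext => x; rewrite /W ipBr !ipBl.
  have O := orthogonal_closures p_gt0 q_gt0 pq_conj.
  apply: null_integralB; apply: null_integralB.
  - exact: O phi1 phi2.
  - exact: O phi1 psi2.
  - exact: O psi1 phi2.
  - exact: O psi1 psi2.
have mphi1 : vmeasurable phi.1 by case: phi1 => -[].
have mpsi1 : vmeasurable psi.1 by case: psi1 => -[].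
pose delta x := F.1 x + phi.1 x - (off P F.1 x + psi.1 x).
have mdelta : vmeasurable delta.
  apply: vmeasurableB; first exact: vmeasurableD.
  by apply: vmeasurableD => //; exact: vmeasurable_off.
pose h x := (P x)%:R * (bracket p q F x + `|F.1 x| ^+ 2 * `|psi.1 x| `^ (p - 2)).
have h0 x : 0 <= h x.
  by rewrite mulr_ge0 // addr_ge0 ?bracket_ge0 // mulr_ge0 ?sqr_ge0 ?powR_ge0.
have mh : measurable_fun setT h.
  apply: measurable_funM.
    rewrite (_ : (fun x => _) = fun x => if P x then 1 else 0); last first.
      by apply/funext => x; case: (P x).
    exact: measurable_fun_ifT.
  apply: measurable_funD; first exact: measurable_bracket.
  apply: measurable_funM.
    by apply: measurable_funX; exact: measurable_norm_vmeasurable.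
  by apply: measurable_powR_fun; exact: measurable_norm_vmeasurable.
have mdp : measurable_fun setT (fun x => `|delta x| `^ p).
  by apply: measurable_powR_fun; exact: measurable_norm_vmeasurable.
(* The negative part of [W] stands on the left, so that only nonnegative
   functions are integrated and [h] may have an infinite integral. *)
have key : {ae mu, forall x, setT x ->
    ((m / 4 * `|delta x| `^ p)%:E + (EFin \o W)^\- x <=
     (EFin \o W)^\+ x + (C * h x)%:E)%E}.
  move: phiA psiA; apply: filterS2 => x hphi hpsi _.
  suff : m / 4 * `|delta x| `^ p <= W x + C * h x.
    rewrite funeposE funenegE /= -!EFin_max -!EFinD lee_fin.
    rewrite /Num.max; case: (ltP (- W x) 0) => ?; case: (ltP (W x) 0) => ? ?; lra.
  pose xi := F.1 x + phi.1 x; pose eta := off P F.1 x + psi.1 x.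
  pose a := F.1 x - off P F.1 x; pose b := F.2 x - off P F.2 x.
  have subK (u v w z : V) : u + v - (w + z) - (u - w) = v - z.
    by rewrite [- (w + z)]opprD addrACA [_ + (v - z)]addrC addrK.
  have WE : W x = ip (A x xi - A x eta - b) (xi - eta - a).
    by rewrite /W /xi /eta hphi hpsi /a /b !subK.
  have norm_ineq : `|xi| <= `|eta| + `|xi - eta|.
    by rewrite -[X in `|X| <= _](subrKC eta) ler_normD.
  have r0 : 0 <= p - 2 by rewrite subr_ge0.
  have hS1 : `|xi - eta| `^ (p - 2) <= (`|xi| + `|eta|) `^ (p - 2).
    by apply: powR_mono => //; exact: ler_normB.
  have hS2 : (`|xi| + `|eta|) `^ (p - 2) <= (2 * `|eta| + `|xi - eta|) `^ (p - 2).
    by apply: powR_mono => //; rewrite ?addr_ge0 //; lra.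
  have := HC _ _ `|a| `|b| _ (normr_ge0 _) (normr_ge0 _) (normr_ge0 _)
    (normr_ge0 _) hS1 hS2.
  have hP : `|a| `^ p + `|b| `^ q + `|a| ^+ 2 * `|eta| `^ (p - 2) = h x.
    rewrite /a /b /eta !subr_off /h /bracket /off.
    case: (P x); first by rewrite add0r mul1r.
    by rewrite !normr0 !powR0 ?gt_eqF // expr0n /= !mul0r !addr0.
  rewrite hP => ineq; apply: le_trans ineq _; rewrite lerD2r WE.
  have lip := A_lip x xi eta; have mono := A_mono x xi eta.
  have c2' := ler_wpM2r (normr_ge0 a) lip.
  clearbody a b; move: (A x xi - A x eta) (xi - eta) lip mono c2' => Z dl _ mono c2'.
  rewrite ipBr !ipBl.
  have c1 := norm_ip_le ip_norm b dl.
  have c2 := norm_ip_le ip_norm Z a.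
  have c3 := norm_ip_le ip_norm b a.
  move: c1 c2 c3; rewrite !ler_norml => /andP[_ c1] /andP[_ c2] /andP[c3 _].
  rewrite [`|a| * `|b|]mulrC; lra.
have mW : measurable_fun setT (EFin \o W) by exact: measurable_int iW.
have Wneg_fin := integrable_neg_fin_num measurableT iW.
have WE : (\int[mu]_x (EFin \o W)^\+ x = \int[mu]_x (EFin \o W)^\- x)%E.
  move: W0; rewrite integralE => W0.
  by rewrite -[LHS](subeK _ Wneg_fin) W0 add0e.
have mm40 : 0 <= m / 4 by rewrite divr_ge0 // ltW.
have {key} : (\int[mu]_x ((m / 4 * `|delta x| `^ p)%:E + (EFin \o W)^\- x) <=
    \int[mu]_x ((EFin \o W)^\+ x + (C * h x)%:E))%E.
  apply: ae_ge0_le_integral => //.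
  - by move=> x _; rewrite adde_ge0 // lee_fin mulr_ge0 // powR_ge0.
  - apply: emeasurable_funD; last exact: measurable_funeneg.
    by apply/measurable_EFinP; exact: measurable_funM.
  - by move=> x _; rewrite adde_ge0 // lee_fin mulr_ge0.
  - apply: emeasurable_funD; first exact: measurable_funepos.
    by apply/measurable_EFinP; exact: measurable_funM.
rewrite ge0_integralD //; last 3 first.
- by move=> x _; rewrite lee_fin mulr_ge0 // powR_ge0.
- by apply/measurable_EFinP; exact: measurable_funM.
- exact: measurable_funeneg.
rewrite ge0_integralD //; last 3 first.
- exact: measurable_funepos.
- by move=> x _; rewrite lee_fin mulr_ge0.
- by apply/measurable_EFinP; exact: measurable_funM.
rewrite WE addeC leeD2lE //.
have mdE : measurable_fun setT (fun x => (`|delta x| `^ p)%:E).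
  exact/measurable_EFinP.
have mhE : measurable_fun setT (EFin \o h) by exact/measurable_EFinP.
have dE0 x : setT x -> (0 <= (`|delta x| `^ p)%:E)%E by rewrite lee_fin powR_ge0.
have hE0 x : setT x -> (0 <= (EFin \o h) x)%E by rewrite lee_fin.
under eq_integral do rewrite EFinM.
rewrite (ge0_integralZl mu measurableT mdE dE0) ?lee_fin //.
under [in leRHS]eq_integral do rewrite EFinM.
rewrite (ge0_integralZl mu measurableT mhE hE0) ?lee_fin //.
move=> ineq.
have m4 : (0 <= (4 / m)%:E)%E by rewrite lee_fin divr_ge0 // ltW.
have := lee_wpmul2l m4 ineq.
rewrite !muleA -!EFinM (_ : 4 / m * (m / 4) = 1) ?mul1e //.
by field; rewrite gt_eqF.
Qed.

End Energy.

(** * The solution operator at a fixed level *)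

(** Collects the triangle inequalities: [a, b] are the sizes of the data,
    [al, be] those of the solution, [a', al'] those of the comparison data and
    solution, [xi] that of the point on the graph, [dl] the distance of the two
    points on the graph. *)
Lemma solution_size_le (R : realType) (p q L : R) :
  2 <= p -> 0 < q -> p^-1 + q^-1 = 1 -> 0 < L ->
  exists2 K : R, 0 < K & forall a b al be a' al' xi dl : R,
    0 <= a -> 0 <= b -> 0 <= al -> 0 <= be -> 0 <= a' -> 0 <= al' ->
    0 <= xi -> 0 <= dl ->
    al <= xi + a -> be <= L * xi `^ (p - 1) + b -> xi <= a' + al' + dl ->
    al `^ p + be `^ q <=
      K * (a `^ p + b `^ q + a' `^ p + al' `^ p + dl `^ p).
Proof.
move=> p2 q0 pq L0; have p0 : 0 < p by lra.
have q0' := ltW q0; have p0' := ltW p0; have L0' := ltW L0.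
have pqE : (p - 1) * q = p.
  have h : q + p = p * q.
    by rewrite -[RHS]mul1r -pq; field; rewrite !gt_eqF.
  by rewrite mulrBl mul1r -h addrAC subrr add0r.
pose c : R := 2 `^ p; pose e : R := 2 `^ q; pose l : R := L `^ q.
have c0 : 0 < c by rewrite powR_gt0.
have e0 : 0 < e by rewrite powR_gt0.
have l0 : 0 < l by rewrite powR_gt0.
pose M := c + e * l; have M0 : 0 < M by rewrite addr_gt0 // mulr_gt0.
have Mc : 0 < M * c by rewrite mulr_gt0.
have Mcc : 0 < M * c * c by rewrite mulr_gt0.
exists (c + e + M * c + M * c * c); first by rewrite !addr_gt0.
move=> a b al be a' al' xi dl a0 b0 al0 be0 a'0 al'0 xi0 dl0 hal hbe hxi.
have h1 : al `^ p <= c * (xi `^ p + a `^ p).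
  by apply: le_trans (powR_mono p0' al0 hal) _; exact: powRD_le.
have h2 : be `^ q <= e * (l * xi `^ p + b `^ q).
  apply: le_trans (powR_mono q0' be0 hbe) _.
  rewrite -{2}pqE powRrM -powRM ?powR_ge0 //.
  by apply: powRD_le => //; rewrite mulr_ge0 ?powR_ge0.
have h3 : xi `^ p <= c * (c * (a' `^ p + al' `^ p) + dl `^ p).
  apply: le_trans (powR_mono p0' xi0 hxi) _.
  apply: le_trans (powRD_le p0' (addr_ge0 a'0 al'0) dl0) _.
  by rewrite ler_wpM2l ?(ltW c0) // lerD2r; exact: powRD_le.
have h4 := ler_wpM2l (ltW M0) h3.
have n1 := powR_ge0 a p; have n2 := powR_ge0 b q.
have n3 := powR_ge0 a' p; have n4 := powR_ge0 al' p; have n5 := powR_ge0 dl p.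
have t1 := mulr_ge0 (ltW (addr_gt0 (addr_gt0 e0 Mc) Mcc)) n1.
have t2 := mulr_ge0 (ltW (addr_gt0 (addr_gt0 c0 Mc) Mcc)) n2.
have t3 := mulr_ge0 (ltW (addr_gt0 (addr_gt0 c0 e0) Mc)) n3.
have t4 := mulr_ge0 (ltW (addr_gt0 (addr_gt0 c0 e0) Mc)) n4.
have t5 := mulr_ge0 (ltW (addr_gt0 (addr_gt0 c0 e0) Mcc)) n5.
apply: le_trans (lerD h1 h2) _.
have -> : c * (xi `^ p + a `^ p) + e * (l * xi `^ p + b `^ q) =
  M * xi `^ p + c * a `^ p + e * b `^ q by rewrite /M; ring.
apply: le_trans (lerD (lerD h4 (lexx _)) (lexx _)) _.
rewrite -subr_ge0; set lhs := (X in 0 <= X).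
suff -> : lhs = (e + M * c + M * c * c) * a `^ p
  + (c + M * c + M * c * c) * b `^ q + (c + e + M * c) * a' `^ p
  + (c + e + M * c) * al' `^ p + (c + e + M * c * c) * dl `^ p.
  by rewrite !addr_ge0.
by rewrite /lhs; ring.
Qed.

Section Operator.
Context (R : realType) (d : measure_display) (X : measurableType d)
  (mu : {measure set X -> \bar R}) (V : normedVectType R)
  (ip : {dot V for idfun}).
Hypothesis ip_norm : induces_norm ip.
Context (p q L m : R) (A : X -> V -> V) (H : set (X -> V)).
Hypotheses (p_ge2 : 2 <= p) (q_ge1 : 1 <= q) (pq_conj : p^-1 + q^-1 = 1).
Hypotheses (L_gt0 : 0 < L) (m_gt0 : 0 < m).
Hypothesis A_struct : structure_conditions mu ip p L m A.
Implicit Types F G phi psi : (X -> V) * (X -> V).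

Let p_gt0 : 0 < p. Proof. exact: lt_le_trans p_ge2. Qed.
Let p_gt1 : 1 < p. Proof. by apply: lt_le_trans p_ge2; rewrite ltr1n. Qed.
Let q_gt0 : 0 < q. Proof. exact: lt_le_trans q_ge1. Qed.

Lemma field0 x : A x 0 = 0.
Proof.
have [_ _ hom _ _] := A_struct.
have := hom x 0 0 (lexx 0); rewrite scale0r powR0 ?scale0r // gt_eqF //.
by rewrite subr_gt0.
Qed.

Lemma field_norm_le x v : `|A x v| <= L * `|v| `^ (p - 1).
Proof.
have [_ _ _ lip _] := A_struct.
have := lip x v 0; rewrite field0 !subr0 normr0 addr0 => h.
apply: le_trans h _; rewrite -mulrA ler_wpM2l ?(ltW L_gt0) // le_eqVlt.
have p1 : 0 < p - 1 by rewrite subr_gt0.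
rewrite -(mulr_powRB1 (normr_ge0 v) p1) mulrC (_ : p - 1 - 1 = p - 2) ?eqxx //.
by rewrite -addrA -opprD.
Qed.

Lemma solution_bracket_le : exists2 K : R, 0 < K & forall F G phi psi,
  solves mu ip p q A H F phi -> solves mu ip p q A H G psi ->
  {ae mu, forall x, bracket p q phi x <=
    K * (bracket p q F x + bracket p q G x + bracket p q psi x +
         `|F.1 x + phi.1 x - (G.1 x + psi.1 x)| `^ p)}.
Proof.
have [K K0 HK] := solution_size_le p_ge2 q_gt0 pq_conj L_gt0.
exists K => // F G phi psi [_ _ phiA] _; move: phiA; apply: filterS => x hx.
apply: le_trans (HK `|F.1 x| `|F.2 x| _ _ `|G.1 x| `|psi.1 x|
  `|F.1 x + phi.1 x| `|F.1 x + phi.1 x - (G.1 x + psi.1 x)|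
  _ _ _ _ _ _ _ _ _ _ _) _ => //.
- by rewrite -{1}(addKr (F.1 x) (phi.1 x)) addrC ler_normB.
- apply: le_trans (lerD (field_norm_le x _) (lexx _)); rewrite hx.
  by rewrite -{1}(addKr (F.2 x) (phi.2 x)) addrC ler_normB.
- rewrite -{1}[F.1 x + phi.1 x](subrK (G.1 x + psi.1 x)) addrC.
  by apply: le_trans (ler_normD _ _) _; rewrite lerD2r ler_normD.
rewrite ler_wpM2l ?(ltW K0) // /bracket.
have := powR_ge0 `|G.2 x| q; have := powR_ge0 `|psi.2 x| q.
move: (_ `^ p) (_ `^ q) => *; lra.
Qed.

Lemma Lsp_off (s : \bar R) (P : X -> bool) (f : X -> V) : (1 <= s)%E ->
  measurable_fun setT P -> Lsp mu s f -> Lsp mu s (off P f).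
Proof.
move=> s1 mP [mf ff]; split; first exact: vmeasurable_off.
have le x : `|off P f x| <= `|f x| by rewrite /off; case: (P x); rewrite ?normr0.
have mnf := measurable_norm_vmeasurable mf.
have mno := measurable_norm_vmeasurable (vmeasurable_off mP mf).
move: ff; rewrite /finite_norm unlock; case: s s1 => [r||] // r1.
  have r0 : 0 < r by apply: lt_le_trans ltr01 _; rewrite -lee_fin.
  have mE (h : X -> V) : measurable_fun setT (fun x => `|h x|) ->
      measurable_fun setT (fun x => poweR `|(`|h x|)%:E|%E r).
    move=> mh; apply/measurable_EFinP; apply: measurable_powR_fun.
    exact: measurableT_comp.
  move=> /(lty_poweRy (invr_neq0 (lt0r_neq0 r0))) ff; apply: poweR_lty.
  apply: le_lt_trans ff; apply: ge0_le_integral => //.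
  - by move=> x _; exact: poweR_ge0.
  - exact: mE mno.
  - exact: mE mnf.
  - move=> x _ /=; rewrite lee_fin !normr_id powR_mono //; exact: ltW.
case: ifP => // _; apply: le_lt_trans; apply: le_ess_sup; apply: nearW => x /=.
by rewrite lee_fin !normr_id.
Qed.

Lemma Lstar_off (P : X -> bool) (f : X -> V) :
  measurable_fun setT P -> Lstar mu f -> Lstar mu (off P f).
Proof. by move=> mP Lf s s1; apply: Lsp_off => //; exact: Lf. Qed.

Lemma Lstar_vmeasurable (f : X -> V) : Lstar mu f -> vmeasurable f.
Proof. by case/(_ 1%E (lexx _)). Qed.

Context (Rop : (X -> V) * (X -> V) -> (X -> V) * (X -> V)).
Hypothesis Rop_sol : solution_operator mu ip p q A H Rop.

Lemma Lstar_solves F : Lstar mu F.1 -> Lstar mu F.2 ->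
  solves mu ip p q A H F (Rop F).
Proof.
by move=> L1 L2; apply: Rop_sol; [apply: L1|apply: L2]; rewrite lee_fin // ltW.
Qed.

Lemma solves_vmeasurable F phi : solves mu ip p q A H F phi ->
  vmeasurable phi.1 /\ vmeasurable phi.2.
Proof. by case=> -[[m1 _] _] [[m2 _] _] _. Qed.

(** The weak-type bound of order [lam] for the part of the data kept by
    [~~ Q t] and the energy estimate for the removed part combine into a bound
    at the level [t].  Which values [Q] selects is left open: for exponents above 1
    the large values of the data are removed, below 1 the small ones.  The
    assumption on [a ^+ 2 * w `^ (p - 2)] is what either choice has to provide
    about the error term of the energy estimate; Kolmogorov's inequality turns
    the minimum into a weak-type quantity. *)
Lemma distribution_estimate (g lam k C2 : R) (Q : R -> R -> bool) :
  0 <= g -> g < lam -> lam < k -> 0 <= C2 ->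
  weak_type mu p q Rop lam ->
  (forall t, measurable_fun setT (Q t)) ->
  (forall t a w y v, 0 < t -> 0 <= a -> 0 <= w -> a `^ p <= y -> w `^ p <= v ->
    Q t y -> a ^+ 2 * w `^ (p - 2) <=
      C2 * (y + Num.min (t `^ (1 - g) * v `^ g) (t `^ (1 - k) * v `^ k))) ->
  exists K C : R, [/\ 0 < K, 0 <= C &
    forall F, Lstar mu F.1 -> Lstar mu F.2 -> forall t, 0 < t ->
    (mu [set x | (K * t < bracket p q (Rop F) x)%R] <=
     C%:E * ((t `^ (- lam))%:E *
               \int[mu]_x (bracket p q F x `^ lam * (~~ Q t (bracket p q F x))%:R)%:E +
             (t `^ (- 1))%:E *
               \int[mu]_x (bracket p q F x * (Q t (bracket p q F x))%:R)%:E))%E].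
Proof.
move=> g0 glam lamk C20 [_ [Cw0 weak]] mQ cross.
have lam0 : 0 < lam by exact: le_lt_trans glam.
have p0 := lt0r_neq0 p_gt0; have q0 := lt0r_neq0 q_gt0.
have [K K0 HK] := solution_bracket_le.
have [C1 C10 HE] := energy_estimate ip_norm H p_ge2 q_gt0 pq_conj L_gt0 m_gt0 A_struct.
have [C3 C30 HC3] := weak_type_integral_min mu g0 glam lamk.
pose Cw := Num.max Cw0 0.
have Cwge0 : 0 <= Cw by rewrite le_max lexx orbT.
pose D1 := 1 + Cw + C1 * C2 * C3 * Cw.
pose D2 := 1 + C1 * (1 + C2).
have D10 : 0 <= D1 by rewrite !addr_ge0 // !mulr_ge0.
have D20 : 0 <= D2 by rewrite addr_ge0 // mulr_ge0 // addr_ge0.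
(* The factor 4 is the number of summands in the bound of [solution_bracket_le]. *)
exists (4 * K), (D1 + D2); split; [by rewrite mulr_gt0|exact: addr_ge0|].
move=> F LF1 LF2 t t0.
have mF1 := Lstar_vmeasurable LF1; have mF2 := Lstar_vmeasurable LF2.
set y := bracket p q F.
have my : measurable_fun setT y by exact: measurable_bracket.
have y0 x : 0 <= y x by exact: bracket_ge0.
pose P x := Q t (y x).
have mP : measurable_fun setT P by exact: (measurableT_comp (mQ t)).
pose G := off2 P F.
have LG1 : Lstar mu G.1 by exact: Lstar_off.
have LG2 : Lstar mu G.2 by exact: Lstar_off.
have solF := Lstar_solves LF1 LF2; have solG := Lstar_solves LG1 LG2.
pose psi := Rop G.
have [mpsi1 mpsi2] := solves_vmeasurable solG.
have [mphi1 mphi2] := solves_vmeasurable solF.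
set z := bracket p q (Rop F); set v := bracket p q psi.
have mz : measurable_fun setT z by exact: measurable_bracket.
have mv : measurable_fun setT v by exact: measurable_bracket.
have v0 x : 0 <= v x by exact: bracket_ge0.
pose dl x := `|F.1 x + (Rop F).1 x - (off P F.1 x + psi.1 x)| `^ p.
have dl0 x : 0 <= dl x by exact: powR_ge0.
have mdl : measurable_fun setT dl.
  apply: measurable_powR_fun; apply: measurable_norm_vmeasurable.
  apply: vmeasurableB; apply: vmeasurableD => //; exact: vmeasurable_off.
have mPr (b : bool) : measurable_fun setT (fun x => (P x == b)%:R : R).
  rewrite (_ : (fun x => _) = fun x => if P x then (true == b)%:R else (false == b)%:R).
    exact: measurable_fun_ifT.
  by apply/funext => x; case: (P x).
have mP1 : measurable_fun setT (fun x => y x * (P x)%:R).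
  rewrite (_ : (fun x => _) = fun x => y x * (P x == true)%:R).
    exact: measurable_funM.
  by apply/funext => x; rewrite eqb_id.
have mP0 : measurable_fun setT (fun x => y x `^ lam * (~~ P x)%:R).
  rewrite (_ : (fun x => _) = fun x => y x `^ lam * (P x == false)%:R).
    by apply: measurable_funM => //; exact: measurable_powR_fun.
  by apply/funext => x; rewrite eqbF_neg.
set I0 := (\int[mu]_x (y x `^ lam * (~~ Q t (y x))%:R)%:E)%E.
set I1 := (\int[mu]_x (y x * (Q t (y x))%:R)%:E)%E.
have I00 : (0 <= I0)%E.
  by apply: integral_ge0 => x _; rewrite lee_fin mulr_ge0 ?powR_ge0.
have I10 : (0 <= I1)%E.
  by apply: integral_ge0 => x _; rewrite lee_fin mulr_ge0.
have weakG s : 0 < s -> (mu [set x | (s < v x)%R] <= (s `^ (- lam))%:E * (Cw%:E * I0))%E.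
  move=> s0; apply: le_trans (weak G LG1 LG2 s s0) _.
  have -> : (\int[mu]_x (bracket p q G x `^ lam)%:E = I0)%E.
    apply: eq_integral => x _; rewrite off2_bracket // powRM //.
    by rewrite /P; case: (Q t _); rewrite /= ?powR1 // powR0 // gt_eqF.
  rewrite muleA [X in (_ <= X * _)%E]muleC; apply: lee_wpmul2r => //.
  by rewrite lee_wpmul2r ?lee_fin ?powR_ge0 // le_max lexx.
pose Phi x := Num.min (t `^ (1 - g) * v x `^ g) (t `^ (1 - k) * v x `^ k).
have Phi0 x : 0 <= Phi x by rewrite le_min !mulr_ge0 ?powR_ge0.
have mPhi : measurable_fun setT Phi.
  by apply: measurable_minr; apply: measurable_funM => //;
    exact: measurable_powR_fun.
have crossI : (\int[mu]_x ((P x)%:R * (y x + `|F.1 x| ^+ 2 * `|psi.1 x| `^ (p - 2)))%:E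
    <= (1 + C2)%:E * I1 + (C2 * C3 * Cw * t `^ (1 - lam))%:E * I0)%E.
  apply: (@le_trans _ _ (\int[mu]_x
      (1 * ((1 + C2) * (y x * (P x)%:R) + C2 * Phi x))%:E)%E).
    apply: ge0_le_integral => //.
    - by move=> x _; rewrite lee_fin mulr_ge0 ?addr_ge0 ?mulr_ge0 ?powR_ge0.
    - apply/measurable_EFinP.
      rewrite (_ : (fun x => _) = fun x => (P x == true)%:R *
          (y x + `|F.1 x| ^+ 2 * `|psi.1 x| `^ (p - 2))).
        apply: measurable_funM => //; apply: measurable_funD => //.
        apply: measurable_funM; last first.
          by apply: measurable_powR_fun; exact: measurable_norm_vmeasurable.
        by apply: measurable_funX; exact: measurable_norm_vmeasurable.
      by apply/funext => x; rewrite eqb_id.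
    - by apply/measurable_EFinP; apply: measurable_funM => //;
        apply: measurable_funD; exact: measurable_funM.
    - move=> x _; rewrite lee_fin mul1r.
      case hP : (P x); last by rewrite mul0r !mulr0 add0r mulr_ge0.
      have Fy : `|F.1 x| `^ p <= y x by rewrite lerDl powR_ge0.
      have pv : `|psi.1 x| `^ p <= v x by rewrite lerDl powR_ge0.
      have := cross _ _ _ _ _ t0 (normr_ge0 _) (normr_ge0 _) Fy pv hP.
      rewrite -/(Phi x) !mulr1 mul1r; lra.
  rewrite ge0_integral_lin2 ?addr_ge0 //; last by move=> x; rewrite mulr_ge0.
  rewrite mul1e leeD2l //.
  have -> : ((C2 * C3 * Cw * t `^ (1 - lam))%:E * I0 =
      C2%:E * ((C3 * t `^ (1 - lam))%:E * (Cw%:E * I0)))%E.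
    by rewrite !muleA -!EFinM; congr (_ * _)%E; congr EFin; ring.
  rewrite lee_wpmul2l ?lee_fin //.
  by apply: HC3 => //; rewrite mule_ge0 ?lee_fin.
have C1E : (0 <= C1%:E)%E by rewrite lee_fin.
have hE := le_trans (HE P F _ _ mP mF1 mF2 solF solG) (lee_wpmul2l C1E crossI).
have pw : {ae mu, forall x, setT x -> (((4 * K * t < z x)%R%:R)%:E <=
   (1 * (t `^ (- lam) * (y x `^ lam * (~~ P x)%:R) + t `^ (- 1) * (y x * (P x)%:R)))%:E
   + ((t < v x)%R%:R)%:E + (t `^ (- 1))%:E * (dl x)%:E)%E}.
  have := HK F G _ _ solF solG; apply: filterS => x hx _.
  have {}hx : z x <= K * (y x + bracket p q G x + v x + dl x) := hx.
  rewrite -EFinM -!EFinD lee_fin mul1r.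
  have yG : bracket p q G x <= y x.
    by rewrite off2_bracket // ler_piMr // lern1 leq_b1.
  have n1 : 0 <= t `^ (- lam) * (y x `^ lam * (~~ P x)%:R) by rewrite !mulr_ge0 ?powR_ge0.
  have n2 : 0 <= t `^ (- 1) * (y x * (P x)%:R) by rewrite !mulr_ge0 ?powR_ge0.
  have n3 : 0 <= (t < v x)%R%:R :> R by [].
  have n4 : 0 <= t `^ (- 1) * dl x by rewrite mulr_ge0 ?powR_ge0.
  have ti (w : R) : t < w -> 1 <= t `^ (- 1) * w.
    by move=> tw; rewrite powR_inv1 ?(ltW t0) // mulrC ler_pdivlMr // mul1r ltW.
  case: ltP => hz; rewrite /= ?mulr1n ?mulr0n; last by rewrite !addr_ge0.
  have [ty|ty] := ltP t (y x).
    suff : 1 <= t `^ (- lam) * (y x `^ lam * (~~ P x)%:R) +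
                t `^ (- 1) * (y x * (P x)%:R) by lra.
    case: (P x); rewrite /= !(mulr0, mulr1, add0r, addr0); first exact: ti.
    rewrite powRN mulrC ler_pdivlMr ?powR_gt0 // mul1r.
    by apply: powR_mono; rewrite ?(ltW lam0) ?(ltW t0) ?(ltW ty).
  move: n3; case: (ltP t (v x)) => vt n3; rewrite /= ?mulr1n ?mulr0n; first by lra.
  have [td|td] := ltP t (dl x); first by have := ti _ td; lra.
  exfalso; move: hz; apply/negP; rewrite -leNgt.
  apply: le_trans hx _; rewrite [4 * K]mulrC -mulrA ler_wpM2l ?(ltW K0) //; lra.
rewrite measure_gt_integral //.
apply: le_trans (ae_ge0_le_integral measurableT _ _ _ _ pw) _.
- by move=> x _; rewrite lee_fin.
- by apply/measurable_EFinP; exact: measurable_gt_natr.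
- move=> x _; rewrite -EFinM -!EFinD lee_fin.
  by rewrite !addr_ge0 ?mulr_ge0 ?addr_ge0 ?mulr_ge0 ?powR_ge0.
- apply: emeasurable_funD; last first.
    by apply: emeasurable_funM => //; exact/measurable_EFinP.
  apply: emeasurable_funD; apply/measurable_EFinP; last exact: measurable_gt_natr.
  apply: measurable_funM => //; apply: measurable_funD; exact: measurable_funM.
have mA : measurable_fun setT (fun x => (1 * (t `^ (- lam) *
    (y x `^ lam * (~~ P x)%:R) + t `^ (- 1) * (y x * (P x)%:R)))%:E).
  apply/measurable_EFinP; apply: measurable_funM => //.
  by apply: measurable_funD; exact: measurable_funM.
have mB : measurable_fun setT (fun x => ((t < v x)%R%:R : R)%:E).
  by apply/measurable_EFinP; exact: measurable_gt_natr.
have mD : measurable_fun setT (fun x => (dl x)%:E) by exact/measurable_EFinP.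
have A0 x : setT x -> (0 <= (1 * (t `^ (- lam) *
    (y x `^ lam * (~~ P x)%:R) + t `^ (- 1) * (y x * (P x)%:R)))%:E)%E.
  by move=> _; rewrite lee_fin mulr_ge0 // addr_ge0 // !mulr_ge0 ?powR_ge0.
have B0 x : setT x -> (0 <= ((t < v x)%R%:R : R)%:E)%E by rewrite lee_fin.
have E0 x : setT x -> (0 <= (dl x)%:E)%E by rewrite lee_fin.
rewrite (ge0_integralD mu measurableT); last 4 first.
- by move=> x Tx; rewrite adde_ge0 ?A0 ?B0.
- exact: emeasurable_funD.
- by move=> x Tx; rewrite mule_ge0 ?E0 // lee_fin powR_ge0.
- exact: emeasurable_funM.
rewrite (ge0_integralD mu measurableT A0 mA B0 mB).
rewrite (ge0_integralZl mu measurableT mD E0) ?lee_fin ?powR_ge0 //.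
rewrite -measure_gt_integral //.
rewrite ge0_integral_lin2 ?powR_ge0 //; last 2 first.
- by move=> x; rewrite mulr_ge0 ?powR_ge0.
- by move=> x; rewrite mulr_ge0.
have -> : (\int[mu]_x (y x `^ lam * (~~ P x)%:R)%:E = I0)%E by [].
have -> : (\int[mu]_x (y x * (P x)%:R)%:E = I1)%E by [].
rewrite mul1e.
have tge0 (r : R) : (0 <= (t `^ r)%:E)%E by rewrite lee_fin powR_ge0.
apply: le_trans (leeD (leeD (lexx _) (weakG t t0)) (lee_wpmul2l (tge0 _) hE)) _.
have t1 : t `^ (- 1) * t `^ (1 - lam) = t `^ (- lam).
  by rewrite -powRD ?(gt_eqF t0) ?implybT //; congr powR; ring.
have u0 : 0 < t `^ (- lam) by rewrite powR_gt0.
have u1 : 0 < t `^ (- 1) by rewrite powR_gt0.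
have DD : 0 < D1 + D2.
  have D1p : 0 < D1 by rewrite /D1 -addrA ltr_pwDl // addr_ge0 // !mulr_ge0.
  by apply: (lt_le_trans D1p); rewrite lerDl.
have : (I0 = +oo \/ I0 \is a fin_num)%E.
  by case: I0 I00 {weakG crossI hE} => [r||]; [right|left|].
case=> [->|fI0].
  rewrite [leRHS](_ : _ = +oo%E) ?leey // gt0_muley ?lte_fin // addye.
    by rewrite gt0_muley // lte_fin.
  by rewrite gt_eqF // (lt_le_trans (ltNyr 0)) // mule_ge0 // lee_fin ltW.
have : (I1 = +oo \/ I1 \is a fin_num)%E.
  by case: I1 I10 {crossI hE} => [r||]; [right|left|].
case=> [->|fI1].
  rewrite [leRHS](_ : _ = +oo%E) ?leey //
    [X in (_ * (_ + X))%E]gt0_muley ?lte_fin // addey.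
    by rewrite gt0_muley // lte_fin.
  by rewrite gt_eqF // (lt_le_trans (ltNyr 0)) // mule_ge0 // lee_fin ltW.
move: I00 I10; rewrite -(fineK fI0) -(fineK fI1) !lee_fin.
move: (fine I0) (fine I1) => r0 r1 r00 r10.
rewrite -?(EFinM, EFinD).
have -> : t `^ (- lam) * r0 + t `^ (- 1) * r1 + t `^ (- lam) * (Cw * r0) +
  t `^ (- 1) * (C1 * ((1 + C2) * r1 + C2 * C3 * Cw * t `^ (1 - lam) * r0)) =
  D1 * (t `^ (- lam) * r0) + D2 * (t `^ (- 1) * r1).
  by rewrite -t1 /D1 /D2; ring.
have j0 : 0 <= D2 * (t `^ (- lam) * r0) by rewrite !mulr_ge0 // ltW.
have j1 : 0 <= D1 * (t `^ (- 1) * r1) by rewrite !mulr_ge0 // ltW.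
rewrite mulrDr !(mulrDl D1 D2); lra.
Qed.

(** * Strong type above, below and at exponent 1 *)

(** Above exponent 1 the large values of the data are removed: the weak-type
    bound applies to what remains, and the energy controls what is removed, for
    which exponent 1 is the lower one. *)
Lemma strong_type_gt1 (lam tau : R) : 1 < tau -> tau < lam ->
  weak_type mu p q Rop lam -> strong_type mu p q Rop tau.
Proof.
move=> tau1 taulam weak.
have [Cy Cy0 HCy] := young_sqr_eps p_ge2 ltr01.
have lam0 : 0 < lam by lra.
have lam1 : 1 < lam by exact: lt_trans taulam.
have lam2 : lam < lam + 1 by rewrite ltrDl.
have Cy1 : 0 <= Cy + 1 by exact: addr_ge0.
have [||K [C [K0 C0 dist]]] := distribution_estimate
  (Q := fun t v => t < v) ler01 lam1 lam2 Cy1 weak.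
- move=> t; apply: measurable_fun_ltr => //.
- move=> t a w y v t0 a0 w0 ay wv ty.
  have v0 : 0 <= v by apply: le_trans wv; exact: powR_ge0.
  set M := Num.min _ _.
  have M0 : 0 <= M by rewrite le_min !mulr_ge0 ?powR_ge0.
  have vM : v <= t + M.
    have [vt|tv] := leP v t; first by lra.
    suff : v <= M by lra.
    rewrite /M le_min subrr powRr0 mul1r powRr1 // lexx /=.
    have v0' : 0 < v by exact: lt_trans tv.
    rewrite (_ : 1 - (lam + 1) = - lam); last by ring.
    rewrite powRD; last by rewrite (gt_eqF v0') implybT.
    rewrite powRr1 // powRN mulrA ler_peMl // mulrC ler_pdivlMr ?powR_gt0 //.
    by rewrite mul1r; apply: powR_mono; exact: ltW.
  have := HCy _ _ a0 w0; have := ler_wpM2l Cy0 ay.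
  have : 0 <= Cy * M by rewrite mulr_ge0.
  rewrite mulrDl mul1r mulrDr; lra.
have [C' C'0 HC'] := interpolation mu ltr01 tau1 taulam K0 C0.
exists C' => F LF1 LF2; apply: HC' => //.
- by apply: measurable_bracket; exact: Lstar_vmeasurable.
- by have [] := solves_vmeasurable (Lstar_solves LF1 LF2); exact: measurable_bracket.
- by move=> x; exact: bracket_ge0.
- by move=> x; exact: bracket_ge0.
move=> t t0; apply: le_trans (dist F LF1 LF2 t t0) _.
rewrite le_eqVlt; apply/orP; left; apply/eqP; rewrite addeC.
congr (_ * (_ * _ + _ * _))%E; apply: eq_integral => x _.
  by rewrite powRr1 ?bracket_ge0.
by rewrite -leNgt.
Qed.

(** Below exponent 1 the roles of large and small values are exchanged.  The
    requirement [1 - 2 / p < lam] makes the error term of the energy estimate,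
    of order [(p - 2) / p] in the bracket, integrable against the weak-type
    bound. *)
Lemma strong_type_lt1 (lam tau : R) : 1 - 2 / p < lam -> lam < tau -> tau < 1 ->
  weak_type mu p q Rop lam -> strong_type mu p q Rop tau.
Proof.
move=> plam lamtau tau1 weak.
have g0 : 0 <= 1 - 2 / p by rewrite subr_ge0 ler_pdivrMr // mul1r.
have pg : p * (1 - 2 / p) = p - 2 by field; rewrite gt_eqF.
have pg' : p * (2 / p) = 2 by field; rewrite gt_eqF.
have lam1 : lam < 1 by exact: lt_trans tau1.
have lam0 : 0 < lam by exact: le_lt_trans plam.
have [||K [C [K0 C0 dist]]] := distribution_estimate
  (Q := fun t v => v <= t) g0 plam lam1 ler01 weak.
- move=> t; exact: measurable_fun_ler.
- move=> t a w y v t0 a0 w0 ay wv yt.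
  have v0 : 0 <= v by apply: le_trans wv; exact: powR_ge0.
  rewrite mul1r; set M := Num.min _ _.
  have M0 : 0 <= M by rewrite le_min !mulr_ge0 ?powR_ge0.
  have y0 : 0 <= y by apply: le_trans ay; exact: powR_ge0.
  have r0 : 0 <= p - 2 by rewrite subr_ge0.
  have [wa|aw] := leP w a.
    apply: (@le_trans _ _ y); last by rewrite lerDl.
    apply: le_trans ay; rewrite -(sqr_mul_powR p_ge2 a0).
    by rewrite ler_wpM2l ?sqr_ge0 // powR_mono.
  suff : a ^+ 2 * w `^ (p - 2) <= M by move=> h; apply: le_trans h _; rewrite lerDr.
  rewrite /M le_min; apply/andP; split; last first.
    rewrite subrr powRr0 mul1r powRr1 //; apply: le_trans wv.
    rewrite -(sqr_mul_powR p_ge2 w0) ler_wpM2r ?powR_ge0 //.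
    by rewrite !expr2 ler_pM // ltW.
  rewrite (_ : 1 - (1 - 2 / p) = 2 / p); last by ring.
  rewrite ler_pM ?powR_ge0 ?sqr_ge0 //.
    rewrite -powR_mulrn // -[X in a `^ X]pg' powRrM powR_mono ?powR_ge0 //.
      by rewrite divr_ge0 // ltW.
    exact: le_trans yt.
  by rewrite -pg powRrM powR_mono ?powR_ge0.
have [C' C'0 HC'] := interpolation mu lam0 lamtau tau1 K0 C0.
exists C' => F LF1 LF2; apply: HC' => //.
- by apply: measurable_bracket; exact: Lstar_vmeasurable.
- by have [] := solves_vmeasurable (Lstar_solves LF1 LF2); exact: measurable_bracket.
- by move=> x; exact: bracket_ge0.
- by move=> x; exact: bracket_ge0.
move=> t t0; apply: le_trans (dist F LF1 LF2 t t0) _.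
rewrite le_eqVlt; apply/orP; left; apply/eqP.
congr (_ * (_ * _ + _ * _))%E; apply: eq_integral => x _.
  by rewrite -ltNge.
by rewrite powRr1 ?bracket_ge0.
Qed.

Lemma Lclosure0 (s : R) (S : set (X -> V)) : 0 < s -> S (fun=> 0) ->
  Lclosure mu s%:E S (fun=> 0).
Proof.
move=> s0 S0.
have N0 : Lnorm mu s%:E (fun=> (0 : R)%:E : \bar R) = 0%E.
  by apply: Lnorm0; rewrite eqe gt_eqF.
have L0 : Lsp mu s%:E (fun=> 0 : V).
  split; first exact: vmeasurable_cst.
  rewrite /finite_norm (_ : EFin \o _ = fun=> (0 : R)%:E) ?N0 ?ltry //.
  by apply/funext => x /=; rewrite normr0.
split=> // e e0; exists (fun=> 0); first by split.
rewrite /Ldist (_ : (fun x => _) = fun=> (0 : R)%:E) ?N0 ?lte_fin //.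
by apply/funext => x; rewrite subr0 normr0.
Qed.

Lemma solves0 : H (fun=> 0) ->
  solves mu ip p q A H (fun=> 0, fun=> 0) (fun=> 0, fun=> 0).
Proof.
move=> H0; split => /=.
- exact: Lclosure0.
- apply: Lclosure0 => //; split.
    by have [] := @Lclosure0 2 setT.
  move=> g _; rewrite -[RHS](integral0 mu setT); apply: eq_integral => x _.
  by rewrite ipC linear0r.
- by apply: nearW => x; rewrite !addr0 field0.
Qed.

(** At exponent 1 comparing with the zero solution, that is removing all of
    the data, leaves the classical energy bound. *)
Lemma strong_type_1 : H (fun=> 0) -> strong_type mu p q Rop 1.
Proof.
move=> H0.
have [Cy Cy0 HCy] := young_sqr_eps p_ge2 ltr01.
have [K K0 HK] := solution_bracket_le.
have [C C0 HE] := energy_estimate ip_norm H p_ge2 q_gt0 pq_conj L_gt0 m_gt0 A_struct.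
exists (K * (1 + C * (1 + Cy))) => F LF1 LF2.
have mF1 := Lstar_vmeasurable LF1; have mF2 := Lstar_vmeasurable LF2.
have solF := Lstar_solves LF1 LF2.
have [mphi1 mphi2] := solves_vmeasurable solF.
have E0 : off2 xpredT F = (fun=> 0, fun=> 0) by [].
have sol0 : solves mu ip p q A H (off2 xpredT F) (fun=> 0, fun=> 0).
  by rewrite E0; exact: solves0.
have mT : measurable_fun setT (xpredT : X -> bool) by [].
have hE := HE xpredT F _ _ mT mF1 mF2 solF sol0.
have mF := measurable_bracket p q mF1 mF2.
have mRF := measurable_bracket p q mphi1 mphi2.
pose dl x := `|F.1 x + (Rop F).1 x| `^ p.
have mdl : measurable_fun setT dl.
  apply: measurable_powR_fun; apply: measurable_norm_vmeasurable.
  exact: vmeasurableD.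
have yE (G : (X -> V) * (X -> V)) :
    (\int[mu]_x (bracket p q G x `^ 1)%:E = \int[mu]_x (bracket p q G x)%:E)%E.
  by apply: eq_integral => x _; rewrite powRr1 ?bracket_ge0.
rewrite !yE; set I := (\int[mu]_x (bracket p q F x)%:E)%E.
have hdl : (\int[mu]_x (dl x)%:E <= (C * (1 + Cy))%:E * I)%E.
  rewrite EFinM -muleA; apply: le_trans (le_trans hE (lee_wpmul2l _ _)).
  - rewrite le_eqVlt; apply/orP; left; apply/eqP; apply: eq_integral => x _.
    by rewrite /= /off !addr0 subr0.
  - by rewrite lee_fin.
  rewrite -ge0_integralZl ?lee_fin ?addr_ge0 //; last 2 first.
  - exact/measurable_EFinP.
  - by move=> x _; rewrite lee_fin bracket_ge0.
  apply: ge0_le_integral => //.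
  - by move=> x _; rewrite lee_fin mul1r addr_ge0 ?bracket_ge0 // mulr_ge0 ?powR_ge0.
  - apply/measurable_EFinP; apply: measurable_funM => //.
    apply: measurable_funD => //. rewrite /=.
    apply: measurable_funM => //.
    by apply: measurable_funX; exact: measurable_norm_vmeasurable.
  - by apply/measurable_EFinP; exact: measurable_funM.
  move=> x _; rewrite -EFinM lee_fin mul1r mulrDl mul1r lerD2l normr0.
  apply: le_trans (HCy _ _ (normr_ge0 _) (lexx 0)) _.
  rewrite powR0 ?gt_eqF // mulr0 add0r ler_wpM2l // /bracket.
  by rewrite lerDl powR_ge0.
have key : {ae mu, forall x, setT x -> ((bracket p q (Rop F) x)%:E <=
    (K * (1 * bracket p q F x + 1 * dl x))%:E)%E}.
  have := HK _ _ _ _ solF sol0; apply: filterS => x hx _.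
  rewrite lee_fin !mul1r; apply: le_trans hx _; rewrite ler_wpM2l ?(ltW K0) //.
  rewrite /bracket /off2 /off /= !normr0 !powR0 ?gt_eqF // !addr0 subr0.
  exact: lexx.
apply: le_trans (ae_ge0_le_integral measurableT _ _ _ _ key) _.
- by move=> x _; rewrite lee_fin bracket_ge0.
- exact/measurable_EFinP.
- move=> x _; rewrite lee_fin mulr_ge0 ?(ltW K0) // addr_ge0 // mul1r.
    exact: bracket_ge0.
  exact: powR_ge0.
- apply/measurable_EFinP; apply: measurable_funM => //.
  by apply: measurable_funD; exact: measurable_funM.
rewrite ge0_integral_lin2 ?(ltW K0) //; last 2 first.
- by move=> x; exact: bracket_ge0.
- by move=> x; exact: powR_ge0.
rewrite !mul1e EFinM -muleA lee_wpmul2l ?lee_fin ?(ltW K0) //.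
rewrite EFinD ge0_muleDl ?lee_fin ?mulr_ge0 ?addr_ge0 // mul1e leeD2l //.
Qed.

End Operator.

Unset Implicit Arguments.

Theorem theorem5p2 (R : realType) (d : measure_display) (X : measurableType d)
  (mu : {sigma_finite_measure set X -> \bar R})
  (V : normedVectType R) (ip : {dot V for idfun})
  (ip_norm : induces_norm ip)
  (L2plus : set (X -> V)) (L2plus_closed : closed_subspaceL2 mu L2plus)
  (q0 : R) (q0_ge1 : 1 <= q0) (q0_lt2 : q0 < 2)
  (Pi_weak : weak_type_projection mu ip L2plus q0)
  (p0 : \bar R) (p0_conj : p0 = hoelder_conjugate q0%:E)
  (p q : R) (pq_conj : p^-1 + q^-1 = 1)
  (q0_lt_q : q0 < q) (q_le_p : q <= p) (p_lt_p0 : (p%:E < p0)%E)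
  (A : X -> V -> V) (L m : R) (L_gt0 : 0 < L) (m_gt0 : 0 < m)
  (A_struct : structure_conditions mu ip p L m A)
  (Rop : (X -> V) * (X -> V) -> (X -> V) * (X -> V))
  (Rop_sol : solution_operator mu ip p q A L2plus Rop)
  (lminus lplus : R)
  (lminus_ge : q0 / q <= lminus) (lminus_lt1 : lminus < 1)
  (lplus_gt1 : 1 < lplus) (lplus_le : (lplus%:E <= p0 / p%:E)%E)
  (weak_minus : weak_type mu p q Rop lminus)
  (weak_plus : weak_type mu p q Rop lplus)
  (tau : R) (tau_gt : lminus < tau) (tau_lt : tau < lplus) :
  strong_type mu p q Rop tau.
Proof.
have q_ge1 : 1 <= q by lra.
have q_gt0 : 0 < q by lra.
have p_gt0 : 0 < p by lra.
have pV_le : p^-1 <= 2^-1.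
  have : p^-1 <= q^-1 by rewrite lef_pV2 ?posrE.
  lra.
have p_ge2 : 2 <= p by rewrite -lef_pV2 ?posrE.
have [tau1|tau1|tau1] := ltgtP tau 1.
- apply: (strong_type_lt1 ip_norm p_ge2 q_ge1 pq_conj L_gt0 m_gt0 A_struct
    Rop_sol _ tau_gt tau1 weak_minus).
  apply: lt_le_trans lminus_ge.
  have : q^-1 <= q0 / q by rewrite ler_peMl // invr_ge0 ltW.
  have : 0 < p^-1 by rewrite invr_gt0.
  lra.
- exact: (strong_type_gt1 ip_norm p_ge2 q_ge1 pq_conj L_gt0 m_gt0 A_struct
    Rop_sol tau1 tau_lt weak_plus).
- rewrite tau1; have [_ H0 _ _] := L2plus_closed.
  exact: (strong_type_1 ip_norm p_ge2 q_ge1 pq_conj L_gt0 m_gt0 A_struct Rop_sol H0).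
Qed.
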